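(* Let $(\bar{S},\bar{D})$ be an $(N+1)$-dimensional securities market model with gains process $\bar G=\bar S+\bar D$, $d\bar G=\bar\mu\,dt+\bar\sigma\,dW$. Let $\bar b$ be a money market account for $(\bar S,\bar D)$ with value process $M$ and interest rate process $r$, and assume $\bar D\in\mathcal{L}(1/M)$. Then the following statements are equivalent: (1) $(\bar{S},\bar{D})$ is instantaneously arbitrage-free. (2) There exists a vector of instantaneous prices of risk, i.e. an adapted measurable $K$-dimensional row-vector-valued process $\lambda$ such that $\bar\mu-r\bar S=\bar\sigma\lambda^\top$ almost everywhere. (3) There exists a trading strategy $\bar{\psi}$ such that $$\bar{\mu} - r \bar{S} = \bar{\sigma}\bar{\sigma}^{\top}\bar{\psi}^{\top}$$ almost everywhere.
   Context: Setting: $(\Omega,\mathcal{F},P)$ is a complete probability space with a filtration $\{\mathcal{F}_t\}_{t\in\mathcal{T}}$, where $\mathcal{T}$ is the time interval ($[0,T]$ or $[0,\infty)$), and $W$ is a $K$-dimensional Wiener process relative to the filtration. ''Measurable'' process means jointly measurable on $\Omega\times\mathcal{T}$; ''almost everywhere'' and ''positive measure'' refer to the product of $P$ and Lebesgue measure on $\Omega\times\mathcal{T}$. $\mathcal{L}^1$ (resp. $\mathcal{L}^2$) is the set of adapted, measurable, pathwise integrable (resp. pathwise square integrable) processes (over each $[0,t]$, $t\in\mathcal T$). Time integrals and stochastic integrals of such processes are understood to be continuous adapted processes, and equality of such processes is up to indistinguishability. Securities market model: a pair $(\bar S,\bar D)$ of adapted measurable $(N+1)$-dimensional (column vector) processes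 (prices and cumulative dividends) with $\bar D(0)=0$ such that $\bar G=\bar S+\bar D$ is an Itô process: $\bar G(t)=\bar G(0)+\int_0^t\bar\mu\,ds+\int_0^t\bar\sigma\,dW$, with $\bar\mu$ an $(N+1)$-dimensional process in $\mathcal{L}^1$ and $\bar\sigma$ an $(N+1)\times K$ matrix-valued process in $\mathcal{L}^2$. A trading strategy is an adapted, measurable $(N+1)$-dimensional row-vector-valued process $\bar\Delta$; its value process is $\bar\Delta\bar S$. $\mathcal{L}(\bar G)$ is the set of trading strategies with $\bar\Delta\bar\mu\in\mathcal{L}^1$, $\bar\Delta\bar\sigma\in\mathcal{L}^2$. A trading strategy $\bar\Delta\in\mathcal{L}(\bar G)$ is self-financing if $\bar\Delta(t)\bar S(t)=\bar\Delta(0)\bar S(0)+\int_0^t\bar\Delta\,d\bar G$ for all $t$. A money market account is a self-financing trading strategy $\bar b$ whose value process $M=\bar b\bar S$ is positive and instantaneously riskless (zero dispersion, i.e. zero $dW$-coefficient). Then $M(t)=M(0)\exp\{\int_0^t r\,ds\}$ for some $r\in\mathcal{L}^1$, the interest rate process. The condition $\bar D\in\mathcal{L}(1/M)$ is equivalent to $\bar D r\in\mathcal{L}^1$. A trading strategy $\bar\Delta$ is instantaneously riskless if $\bar\Delta\bar\sigma=0$ almost everywhere. A zero-value instantaneous arbitrage trading strategy is an instantaneously riskless trading strategy $\bar\Delta$ such that $\bar\Delta\bar S=0$ almost everywhere, $\bar\Delta\bar\mu\ge 0$ almost everywhere, and $\bar\Delta\bar\mu>0$ on a set of positive measure. $(\bar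 S,\bar D)$ is instantaneously arbitrage-free if there exists no zero-value instantaneous arbitrage trading strategy. *)

(* Defs.v *)
From HB Require Import structures.
From mathcomp Require Export all_boot all_order all_algebra.
From mathcomp Require Export all_classical all_reals all_analysis.

Set Implicit Arguments.
Unset Strict Implicit.
Unset Printing Implicit Defensive.
Import Order.TTheory GRing.Theory Num.Theory.
Import numFieldNormedType.Exports.

Local Open Scope classical_set_scope.
Local Open Scope ring_scope.

(* A process is a function of the scenario and of time, defined for all real
   times; only its values at times in the time interval TT are ever used.
   Scalar processes are real-valued. Vector- and matrix-valued ones are valued
   in 'M_(m, n): prices, dividends and drifts are columns, trading strategies
   and prices of risk are rows. *)

Section Setting.
Context (R : realType).

Definition time_interval (TT : set R) : Prop :=
  (exists T : R, 0 < T /\ TT = `[0, T]%classic) \/ TT = `[0, +oo[%classic.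

Context (d : measure_display) (Omega : measurableType d).
Context (P : probability Omega R) (TT : set R) (F : R -> set (set Omega)).

Definition filtration : Prop :=
  (forall t, TT t -> sigma_algebra setT (F t) /\ F t `<=` measurable) /\
  (forall s t, TT s -> TT t -> s <= t -> F s `<=` F t).

Definition wrt_sigma_algebra (G : set (set Omega)) (f : Omega -> R) : Prop :=
  forall B : set R, measurable B -> G (f @^-1` B).

Definition adapted (X : Omega -> R -> R) : Prop :=
  forall t, TT t -> wrt_sigma_algebra (F t) (X ^~ t).

Definition jointly_measurable (X : Omega -> R -> R) : Prop :=
  measurable_fun (setT `*` TT) (fun z : Omega * R => X z.1 z.2).

(* Almost surely, simultaneously for all times. *)
Definition as_all_times (Q : Omega -> R -> Prop) : Prop :=
  {ae P, forall w, forall t, TT t -> Q w t}.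

(* Almost everywhere on Omega x TT. *)
Definition aeverywhere (Q : Omega -> R -> Prop) : Prop :=
  {ae (P \x lebesgue_measure)%E,
    forall z : Omega * R, TT z.2 -> Q z.1 z.2}.

Definition on_positive_measure (Q : Omega -> R -> Prop) : Prop :=
  (0 < (P \x lebesgue_measure)%E [set z : Omega * R | TT z.2 /\ Q z.1 z.2])%E.

Definition calL1 (X : Omega -> R -> R) : Prop :=
  [/\ adapted X, jointly_measurable X &
    as_all_times (fun w t =>
      lebesgue_measure.-integrable `[0, t] (fun s => (X w s)%:E))].

Definition calL2 (X : Omega -> R -> R) : Prop :=
  [/\ adapted X, jointly_measurable X &
    as_all_times (fun w t =>
      lebesgue_measure.-integrable `[0, t] (fun s => (X w s ^+ 2)%:E))].

Section MatrixProcesses.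
Context (m n : nat).
Implicit Type X : Omega -> R -> 'M[R]_(m, n).

Definition entry X (i : 'I_m) (j : 'I_n) : Omega -> R -> R :=
  fun w t => X w t i j.

Definition adapted_measurable X : Prop :=
  forall i j, adapted (entry X i j) /\ jointly_measurable (entry X i j).

Definition mx_calL1 X : Prop := forall i j, calL1 (entry X i j).

Definition mx_calL2 X : Prop := forall i j, calL2 (entry X i j).

Definition time_integral X (w : Omega) (t : R) : 'M[R]_(m, n) :=
  \matrix_(i, j) \int[lebesgue_measure]_(s in `[0, t]) X w s i j.

End MatrixProcesses.

(* For s < t, the increment W(t) - W(s) is independent of F(s) and its
   components are independent, normal with mean 0 and variance t - s. The
   second argument of normal_prob is the standard deviation. *)
Definition wiener_process (K : nat) (W : Omega -> R -> 'rV[R]_K) : Prop :=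
  [/\ forall k, adapted (entry W 0 k),
      {ae P, forall w, W w 0 = 0},
      {ae P, forall w, forall k, {within TT, continuous (entry W 0 k w)}} &
      forall s t, TT s -> TT t -> s < t ->
      forall (A : set Omega) (B : 'I_K -> set R),
        F s A -> (forall k, measurable (B k)) ->
        (P (A `&` [set w | forall k, B k (W w t 0 k - W w s 0 k)%R]) =
         P A * \prod_(k < K) normal_prob 0%R (Num.sqrt (t - s))%R (B k))%E].

(* The process which equals si_coef i on ]si_knot i, si_knot i.+1], for
   i < si_steps, and 0 elsewhere. *)
Record simple_integrand := SimpleIntegrand {
  si_steps : nat;
  si_knot : nat -> R;
  si_coef : nat -> Omega -> R;
  si_knot_time : forall i, (i <= si_steps)%N -> TT (si_knot i);
  si_knot_le : forall i, (i < si_steps)%N -> si_knot i <= si_knot i.+1;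
  si_coef_meas : forall i, (i < si_steps)%N ->
    wrt_sigma_algebra (F (si_knot i)) (si_coef i);
  si_coef_bounded : exists C : R,
    forall i w, (i < si_steps)%N -> `|si_coef i w| <= C }.

Definition si_process (h : simple_integrand) : Omega -> R -> R := fun w s =>
  \sum_(i < si_steps h) si_coef h i w * \1_(`]si_knot h i, si_knot h i.+1]) s.

Definition si_integral (B : Omega -> R -> R) (h : simple_integrand) :
  Omega -> R -> R := fun w t =>
  \sum_(i < si_steps h) si_coef h i w *
    (B w (Num.min (si_knot h i.+1) t) - B w (Num.min (si_knot h i) t)).

(* Convergence to 0 in probability; the values may be infinite. *)
Definition cvg0_in_probability (X : nat -> Omega -> \bar R) : Prop :=
  forall e : R, 0 < e ->
    P [set w | (e%:E < `|X n w|)%E] @[n --> \oo] --> (0 : \bar R).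

(* Z is (a version of) the Ito integral of the scalar process H in L2 with
   respect to the scalar Wiener process B: the adapted, almost surely
   continuous process which is, at each time, the limit in probability of the
   elementary integrals of simple processes h n whenever int_0^t |h n - H|^2
   tends to 0 in probability. It is unique up to indistinguishability and does
   not depend on the approximating sequence. *)
Definition is_scalar_ito_integral (B H Z : Omega -> R -> R) : Prop :=
  [/\ adapted Z,
      {ae P, forall w, {within TT, continuous (Z w)}} &
      exists h : nat -> simple_integrand, forall t, TT t ->
        cvg0_in_probability (fun n w =>
          \int[lebesgue_measure]_(s in `[0%R, t])
            ((si_process (h n) w s - H w s) ^+ 2)%R%:E)%E /\
        cvg0_in_probability (fun n w => (si_integral B (h n) w t - Z w t)%:E)].

Section ItoProcesses.
Context (K : nat) (W : Omega -> R -> 'rV[R]_K).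

Definition is_ito_integral (m : nat) (H : Omega -> R -> 'M[R]_(m, K))
    (Z : Omega -> R -> 'cV[R]_m) : Prop :=
  exists Y : Omega -> R -> 'M[R]_(m, K),
    (forall i k,
      is_scalar_ito_integral (entry W 0 k) (entry H i k) (entry Y i k)) /\
    (forall w t i, Z w t i 0 = \sum_(k < K) Y w t i k).

Definition ito_process (m : nat) (X mu : Omega -> R -> 'cV[R]_m)
    (sigma : Omega -> R -> 'M[R]_(m, K)) : Prop :=
  [/\ adapted_measurable X, mx_calL1 mu, mx_calL2 sigma &
    exists Z, is_ito_integral sigma Z /\
      as_all_times (fun w t => X w t = X w 0 + time_integral mu w t + Z w t)].

(* Membership in the class L(X), for X an Ito process with drift mu and
   dispersion sigma. *)
Definition integrand_for (m n : nat) (mu : Omega -> R -> 'cV[R]_m)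
    (sigma : Omega -> R -> 'M[R]_(m, K))
    (Delta : Omega -> R -> 'M[R]_(n, m)) : Prop :=
  [/\ adapted_measurable Delta,
      mx_calL1 (fun w t => Delta w t *m mu w t) &
      mx_calL2 (fun w t => Delta w t *m sigma w t)].

(* Drift and dispersion of an Ito process are unique almost everywhere, and
   integrand_for does not distinguish between versions of them. *)
Definition calL (m n : nat) (X : Omega -> R -> 'cV[R]_m)
    (Delta : Omega -> R -> 'M[R]_(n, m)) : Prop :=
  exists (mu : Omega -> R -> 'cV[R]_m) (sigma : Omega -> R -> 'M[R]_(m, K)),
    ito_process X mu sigma /\ integrand_for mu sigma Delta.

Section Securities.
Context (N : nat) (S D mu : Omega -> R -> 'cV[R]_N.+1)
  (sigma : Omega -> R -> 'M[R]_(N.+1, K)).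
Implicit Type Delta : Omega -> R -> 'rV[R]_N.+1.

Definition securities_market_model : Prop :=
  [/\ adapted_measurable S, adapted_measurable D,
      {ae P, forall w, D w 0 = 0} &
      ito_process (fun w t => S w t + D w t) mu sigma].

Definition trading_strategy Delta : Prop := adapted_measurable Delta.

Definition value_process Delta : Omega -> R -> R :=
  fun w t => (Delta w t *m S w t) 0 0.

(* The integral of Delta with respect to the gains process is the sum of the
   time integral of Delta mu and the Ito integral of Delta sigma. *)
Definition self_financing Delta : Prop :=
  [/\ trading_strategy Delta, integrand_for mu sigma Delta &
    exists Z, is_ito_integral (fun w t => Delta w t *m sigma w t) Z /\
      as_all_times (fun w t =>
        Delta w t *m S w t = Delta w 0 *m S w 0 +
          time_integral (fun w t => Delta w t *m mu w t) w t + Z w t)].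

Definition instantaneously_riskless Delta : Prop :=
  aeverywhere (fun w t => Delta w t *m sigma w t = 0).

(* For a self-financing strategy b, the dispersion of the value process b S is
   b sigma. *)
Definition money_market_account (b : Omega -> R -> 'rV[R]_N.+1) : Prop :=
  [/\ self_financing b,
      as_all_times (fun w t => 0 < value_process b w t) &
      instantaneously_riskless b].

Definition zero_value_instantaneous_arbitrage Delta : Prop :=
  [/\ trading_strategy Delta,
      instantaneously_riskless Delta,
      aeverywhere (fun w t => Delta w t *m S w t = 0),
      aeverywhere (fun w t => 0 <= (Delta w t *m mu w t) 0 0) &
      on_positive_measure (fun w t => 0 < (Delta w t *m mu w t) 0 0)].

Definition instantaneously_arbitrage_free : Prop :=
  ~ exists Delta, zero_value_instantaneous_arbitrage Delta.

(* lambda is a vector of instantaneous prices of risk, given the interest rate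
   process r. *)
Definition prices_of_risk (r : Omega -> R -> R)
    (lambda : Omega -> R -> 'rV[R]_K) : Prop :=
  adapted_measurable lambda /\
  aeverywhere (fun w t =>
    mu w t - r w t *: S w t = sigma w t *m (lambda w t)^T).

End Securities.
End ItoProcesses.

Definition interest_rate_process (M r : Omega -> R -> R) : Prop :=
  calL1 r /\
  as_all_times (fun w t =>
    M w t = M w 0 * expR (\int[lebesgue_measure]_(s in `[0, t]) r w s)).

(* A scalar process as a one-dimensional vector process. *)
Definition vec1 (X : Omega -> R -> R) : Omega -> R -> 'cV[R]_1 :=
  fun w t => (X w t)%:M.

End Setting.

(* Main.v *)
(* (1) => (3): project mu - r S orthogonally onto the range of sigma sigma^T.
   Gram-Schmidt uses only field operations, so it produces adapted measurable
   coefficients psi, and the residual e satisfies sigma^T e = 0. The strategy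
   Delta = e^T - (e^T S / M) b has zero value and zero dispersion, and drift
   |e|^2 provided that b mu = r M; so e = 0 in the absence of arbitrage.
   (3) => (2) holds with lambda = psi sigma, and in (2) => (1) every riskless
   strategy of zero value has drift Delta (r S + sigma lambda^T) = 0.

   The equation b mu = r M requires that the stochastic integral of b sigma = 0
   vanishes, i.e. that elementary integrals whose quadratic sum tends to 0 in
   probability tend to 0 in probability. As in Lenglart's inequality, this
   follows from the second moment bound for elementary integrals, truncated
   when the quadratic sum becomes large. Then M(0) + int b mu and
   M(0) exp(int r) are two expressions for M, to be differentiated at almost
   every time. *)
From HB Require Import structures.
Require Import Defs.
From mathcomp Require Import measurable_realfun ring lra.
Set Implicit Arguments.
Unset Strict Implicit.
Unset Printing Implicit Defensive.
Import Order.TTheory GRing.Theory Num.Theory.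
Import numFieldNormedType.Exports.
Local Open Scope classical_set_scope.
Local Open Scope ring_scope.

(** * Least squares with coefficients in a class closed under field operations *)

Section LeastSquares.
Context (T : Type) (R : realFieldType) (C : (T -> R) -> Prop).

(** The inverse is total, with 0^-1 = 0, so closure under it carries no nonvanishing condition.
    Pointwise Gram-Schmidt coefficients thus stay in the class even where columns become
    dependent. *)
Definition field_closed : Prop :=
  [/\ forall c, C (fun=> c),
      forall f g, C f -> C g -> C (fun z => f z + g z),
      forall f g, C f -> C g -> C (fun z => f z * g z) &
      forall f, C f -> C (fun z => (f z)^-1)].

Hypothesis CP : field_closed.

Definition entrywise m n (A : T -> 'M[R]_(m, n)) : Prop :=
  forall i j, C (fun z => A z i j).

Lemma field_closed_sum n (f : 'I_n -> T -> R) :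
  (forall i, C (f i)) -> C (fun z => \sum_(i < n) f i z).
Proof.
case: CP => Cc Ca _ _; elim: n f => [|n IH] f Cf.
  rewrite (_ : (fun _ => _) = fun=> 0) //.
  by apply/funext => z; rewrite big_ord0.
rewrite (_ : (fun _ => _) =
  fun z => \sum_(i < n) f (widen_ord (leqnSn n) i) z + f ord_max z).
  by apply: Ca => //; apply: IH.
by apply/funext => z; rewrite big_ord_recr.
Qed.

Lemma entrywise_mul m n p (A : T -> 'M[R]_(m, n)) (B : T -> 'M[R]_(n, p)) :
  entrywise A -> entrywise B -> entrywise (fun z => A z *m B z).
Proof.
case: (CP) => _ _ Cm _ CA CB i k.
under eq_fun do rewrite mxE.
by apply: field_closed_sum => j; apply: Cm.
Qed.

Lemma entrywise_add m n (A B : T -> 'M[R]_(m, n)) :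
  entrywise A -> entrywise B -> entrywise (fun z => A z + B z).
Proof.
by case: CP => _ Ca _ _ CA CB i k; under eq_fun do rewrite mxE; apply: Ca.
Qed.

Lemma entrywise_scale m n (f : T -> R) (A : T -> 'M[R]_(m, n)) :
  C f -> entrywise A -> entrywise (fun z => f z *: A z).
Proof.
by case: CP => _ _ Cm _ Cf CA i k; under eq_fun do rewrite mxE; apply: Cm.
Qed.

Lemma entrywise_opp m n (A : T -> 'M[R]_(m, n)) :
  entrywise A -> entrywise (fun z => - A z).
Proof.
move=> CA; under eq_fun do rewrite -scaleN1r.
by apply: entrywise_scale => //; case: CP.
Qed.

Lemma entrywise_tr m n (A : T -> 'M[R]_(m, n)) :
  entrywise A -> entrywise (fun z => (A z)^T).
Proof. by move=> CA i k; under eq_fun do rewrite mxE. Qed.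

Lemma entrywise_col_mx m n p (A : T -> 'M[R]_(m, p)) (B : T -> 'M[R]_(n, p)) :
  entrywise A -> entrywise B -> entrywise (fun z => col_mx (A z) (B z)).
Proof.
move=> CA CB i k; under eq_fun do rewrite mxE.
by case: (fintype.split i) => j /=.
Qed.

(** The diagonal entries of [u^T *m u] are the sums of squares of the columns of [u]. *)
Lemma mulmx_tr_eq0 n p (u : 'M[R]_(n, p)) : u^T *m u = 0 -> u = 0.
Proof.
move=> u0; apply/matrixP => i j; rewrite mxE.
have /matrixP/(_ j j) := u0; rewrite !mxE.
move=> /eqP; rewrite psumr_eq0 => [/allP/(_ i)|k _].
  by rewrite mem_index_enum mxE -expr2 sqrf_eq0 => /(_ isT)/eqP.
by rewrite mxE -expr2 sqr_ge0.
Qed.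

(* Gram-Schmidt, one column a of A at a time. When the component a' of a
   orthogonal to the other columns vanishes, the convention 0^-1 = 0 gives the
   right coefficient 0. *)
Lemma least_squares m n (A : T -> 'M[R]_(m, n)) (v : T -> 'cV[R]_m) :
  entrywise A -> entrywise v ->
  exists x : T -> 'cV[R]_n,
    entrywise x /\ forall z, (A z)^T *m (v z - A z *m x z) = 0.
Proof.
elim: n A v => [|n IH] A v CA Cv.
  exists (fun=> 0); split => [[] //|z].
  by apply/matrixP => -[] //.
pose a z := lsubmx (A z : 'M[R]_(m, 1 + n)); pose A' z := rsubmx (A z : 'M[R]_(m, 1 + n)).
have AE z : A z = row_mx (a z) (A' z) by rewrite hsubmxK.
have Ca : entrywise a by move=> i j; rewrite /a; under eq_fun do rewrite mxE; apply: CA.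
have CA' : entrywise A' by move=> i j; rewrite /A' /a; under eq_fun do rewrite mxE; apply: CA.
(* The induction hypothesis is used twice: to project the first column [a], and then the target [v],
   onto the remaining columns [A']. The residuals are [a'] and [v']. *)
have [y [Cy yP]] := IH A' a CA' Ca.
have [u [Cu uP]] := IH A' v CA' Cv.
pose a' z := a z - A' z *m y z; pose v' z := v z - A' z *m u z.
have Ca' : entrywise a'.
  by apply: entrywise_add => //; apply: entrywise_opp; apply: entrywise_mul.
have Cv' : entrywise v'.
  by apply: entrywise_add => //; apply: entrywise_opp; apply: entrywise_mul.
pose s z := ((a' z)^T *m v' z) 0 0 * (((a' z)^T *m a' z) 0 0)^-1.
have Cs : C s.
  case: (CP) => _ _ Cm Ci; apply: Cm; first exact: entrywise_mul (entrywise_tr _) _ _ _.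
  by apply: Ci; exact: entrywise_mul (entrywise_tr _) _ _ _.
(* Since [a = a' + A' y], giving [a] the coefficient [s] requires correcting the coefficients of
   [A'] by [s y]; the total residual is then [v' - s a']. *)
pose x z : 'cV[R]_(1 + n) := col_mx (s z)%:M (u z - s z *: y z).
exists x; split => [|z].
  apply: (@entrywise_col_mx 1 n 1) => [|].
    by move=> i j; under eq_fun do rewrite mxE !ord1 eqxx mulr1n.
  by apply: entrywise_add => //; apply: entrywise_opp; exact: entrywise_scale.
rewrite (_ : _ - _ = v' z - s z *: a' z); last first.
  have -> : A z *m x z = a z *m (s z)%:M + A' z *m (u z - s z *: y z).
    by rewrite AE; apply: (mul_row_col (a z) (A' z) (s z)%:M (u z - s z *: y z)).
  rewrite mulmxBr -scalemxAr mul_mx_scalar /v' /a' scalerBr.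
  by rewrite !opprD !opprK !addrA; congr (_ + _); exact: addrAC.
have o : (A' z)^T *m (v' z - s z *: a' z) = 0.
  by rewrite mulmxBr -scalemxAr yP uP scaler0 subr0.
have -> : (A z)^T = col_mx (a z)^T (A' z)^T.
  by rewrite AE; exact: (tr_row_mx (a z) (A' z)).
transitivity (col_mx ((a z)^T *m (v' z - s z *: a' z))
    ((A' z)^T *m (v' z - s z *: a' z))); first exact: (mul_col_mx (a z)^T (A' z)^T).
transitivity (col_mx (0 : 'M[R]_1) (0 : 'M[R]_(n, 1))); last first.
  by apply/matrixP => i j; rewrite !mxE; case: splitP => k _; rewrite mxE.
suff -> : (a z)^T *m (v' z - s z *: a' z) = 0 by rewrite o.
(* Orthogonality to [A'] is already known in [o], so orthogonality to [a] reduces to orthogonality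
   to [a']. *)
rewrite (_ : a z = a' z + A' z *m y z); last by rewrite subrK.
have -> : (a' z + A' z *m y z)^T = (a' z)^T + (A' z *m y z)^T by exact: linearD.
rewrite mulmxDl trmx_mul -mulmxA o mulmx0 addr0.
rewrite mulmxBr -scalemxAr.
have [a0|a0] := eqVneq (((a' z)^T *m a' z) 0 0) 0.
  have -> : a' z = 0.
    by apply: mulmx_tr_eq0; apply/matrixP => i j; rewrite !ord1 a0 mxE.
  by rewrite trmx0 !mul0mx scaler0 subr0.
apply/matrixP => i j; rewrite !ord1 [LHS]mxE [X in _ + X]mxE [X in _ - X]mxE.
by rewrite /s divfK // subrr mxE.
Qed.

End LeastSquares.

(** * Adapted jointly measurable processes as a class closed under field operations *)

Lemma measurable_invr (R : realType) : measurable_fun [set: R] (@GRing.inv R).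
Proof.
(* The inverse is continuous on the open complement of [0], and every function is measurable on a
   singleton. *)
rewrite -(setvU [set 0]); apply/measurable_funU => //; first exact: measurableC.
split; last exact: measurable_fun_set1.
have o0 : open (~` [set (0 : R)]) by apply: closed_openC; exact: closed_eq.
apply: subspace_continuous_measurable_fun; first exact: measurableC.
rewrite (continuous_open_subspace _ o0).
by move=> x; rewrite inE /= => /eqP x0; exact: inv_continuous.
Qed.

Section RegularProcesses.
Context (R : realType) (d : measure_display) (Omega : measurableType d).
Context (TT : set R) (F : R -> set (set Omega)).

(** Makes the closure lemmas for measurable functions available for a sub-sigma-algebra [G], which
    coincides with the sigma-algebra it generates. *)
Lemma wrt_sigma_algebraP (G : set (set Omega)) (f : Omega -> R) :
  sigma_algebra setT G ->
  wrt_sigma_algebra G f <->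
  measurable_fun setT (f : g_sigma_algebraType G -> R).
Proof.
move=> sG; split=> [mf _ B mB|mf B mB].
  by rewrite setTI; apply: sub_sigma_algebra; exact: mf.
rewrite -[G](sigma_algebra_id sG) -[X in _ X]setTI.
exact: mf.
Qed.

(** Takes functions of the pair of scenario and time, so that this class can be the class [C] of the
    least squares section. *)
Definition regular_process (f : Omega * R -> R) : Prop :=
  adapted TT F (fun w t => f (w, t)) /\
  jointly_measurable TT (fun w t => f (w, t)).

Hypothesis hF : filtration TT F.

Lemma regular_field_closed : field_closed regular_process.
Proof.
case: hF => hsF _; split.
- move=> c; split; last exact: measurable_cst.
  move=> t tT; apply/wrt_sigma_algebraP; first by have [] := hsF t tT.
  exact: measurable_cst.
- move=> f g [af mf] [ag mg]; split; last exact: measurable_funD.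
  move=> t tT; have [sFt _] := hsF t tT; apply/wrt_sigma_algebraP => //.
  by apply: measurable_funD; apply/wrt_sigma_algebraP => //; [exact: af|exact: ag].
- move=> f g [af mf] [ag mg]; split; last exact: measurable_funM.
  move=> t tT; have [sFt _] := hsF t tT; apply/wrt_sigma_algebraP => //.
  by apply: measurable_funM; apply/wrt_sigma_algebraP => //; [exact: af|exact: ag].
- move=> f [af mf]; split.
    move=> t tT; have [sFt _] := hsF t tT; apply/wrt_sigma_algebraP => //.
    apply: measurableT_comp; first exact: measurable_invr.
    by apply/wrt_sigma_algebraP => //; exact: af.
  by apply: measurableT_comp; first exact: measurable_invr.
Qed.

End RegularProcesses.

(** * Second moments of Gaussian increments *)

Section IntegralDensity.
Local Open Scope ereal_scope.
Context d (T : measurableType d) (R : realType).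
Variables (mu nu : {measure set T -> \bar R}) (g : T -> R).
Hypothesis mg : measurable_fun setT g.
Hypothesis g0 : forall x, (0 <= g x)%R.
Hypothesis nuE : forall A, measurable A -> nu A = \int[mu]_(x in A) (g x)%:E.

Import HBNNSimple.

(** By linearity this reduces to indicators, where it is the hypothesis [nuE]. *)
Lemma nnsfun_integral_density (f : {nnsfun T >-> R}) :
  \int[nu]_x (f x)%:E = \int[mu]_x ((f x)%:E * (g x)%:E).
Proof.
under [LHS]eq_integral do rewrite fimfunE -fsumEFin//.
rewrite [LHS]ge0_integral_fsum//; last 2 first.
  - by move=> r; exact/measurable_EFinP/measurableT_comp.
  - by move=> n x _; rewrite EFinM nnfun_muleindic_ge0.
under [RHS]eq_integral.
  move=> x xD; rewrite fimfunE -fsumEFin// muleC ge0_mule_fsumr; last first.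
    by move=> r; rewrite EFinM nnfun_muleindic_ge0.
  over.
rewrite [RHS]ge0_integral_fsum//; last 2 first.
  - move=> r; apply: emeasurable_funM; first exact/measurable_EFinP.
    by apply/measurable_EFinP; exact: measurableT_comp.
  - move=> n x _; apply: mule_ge0; first by rewrite lee_fin.
    by rewrite EFinM nnfun_muleindic_ge0.
apply: eq_fsbigr => r _.
rewrite integralZl_indic_nnsfun//= integral_indic// setIT nuE//.
have [r0|r0] := ltP r 0%R.
  rewrite preimage_nnfun0// integral_set0 mule0 integral0_eq// => x _.
  by rewrite indic0 mulr0 mule0.
under [RHS]eq_integral do rewrite EFinM muleCA.
rewrite ge0_integralZl//; last 2 first.
- by apply: emeasurable_funM; apply/measurable_EFinP.
- by move=> x _; rewrite mule_ge0 ?lee_fin.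
congr (_ * _); rewrite integral_mkcond; apply: eq_integral => x _.
by rewrite patchE indicE; case: ifP => _; rewrite ?mule1 ?mule0.
Qed.

(** Monotone convergence along simple functions increasing to [f], applied on both sides. *)
Lemma ge0_integral_density (f : T -> \bar R) :
  measurable_fun setT f -> (forall x, 0 <= f x) ->
  \int[nu]_x f x = \int[mu]_x (f x * (g x)%:E).
Proof.
move=> mf f0; pose f_ := nnsfun_approx measurableT mf.
have cvf x : (f_ n x)%:E @[n --> \oo] --> f x by exact: cvg_nnsfun_approx.
transitivity (limn (fun n => \int[nu]_x (f_ n x)%:E)).
  rewrite -monotone_convergence//=.
  - by apply: eq_integral => x _; apply/esym/cvg_lim => //; exact: cvf.
  - by move=> n; exact/measurable_EFinP/measurable_funTS.
  - by move=> n x _; rewrite lee_fin.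
  - by move=> x _ m n mn; rewrite lee_fin; exact/lefP/nd_nnsfun_approx.
under eq_fun do rewrite nnsfun_integral_density.
rewrite -monotone_convergence//=.
- apply: eq_integral => x _; apply/cvg_lim => //.
  by apply: cvgeZr; [rewrite fin_numE|exact: cvf].
- move=> n; apply: emeasurable_funM; exact/measurable_EFinP.
- by move=> n x _; rewrite mule_ge0 ?lee_fin.
- move=> x _ m n mn; rewrite lee_wpmul2r ?lee_fin//.
  exact/lefP/nd_nnsfun_approx.
Qed.

End IntegralDensity.

Section NormalMoments.
Context (R : realType).
Implicit Types s a c : R.
Local Notation lebesgue := (@lebesgue_measure R).

(* The exact value s ^+ 2 of the second moment is not needed: any bound linear
   in s ^+ 2 suffices. *)
Lemma sqr_normal_pdf_le s x : s != 0 ->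
  x ^+ 2 * normal_pdf 0 s x <= 6 * s ^+ 2 * normal_pdf 0 (2 * s) x.
Proof.
move=> s0; have s20 : 2 * s != 0 by rewrite mulf_neq0// pnatr_eq0.
have ss : 0 < s ^+ 2 by rewrite exprn_even_gt0.
rewrite !normal_pdfE//.
have -> : normal_peak s = 2 * normal_peak (2 * s).
  have E : Num.sqrt ((2 * s) ^+ 2 * pi *+ 2) = 2 * Num.sqrt (s ^+ 2 * pi *+ 2).
    rewrite (_ : (2 * s) ^+ 2 * pi *+ 2 = 2 ^+ 2 * (s ^+ 2 * pi *+ 2)); last by ring.
    by rewrite sqrtrM ?sqr_ge0// sqrtr_sqr ger0_norm.
  by rewrite /normal_peak E invfM mulrA divff ?mul1r// pnatr_eq0.
rewrite /normal_fun subr0; set u := x ^+ 2 / s ^+ 2.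
have xu : x ^+ 2 = s ^+ 2 * u by rewrite /u mulrC divfK// gt_eqF.
have u0 : 0 <= u by rewrite /u divr_ge0 ?sqr_ge0.
have -> : - x ^+ 2 / (s ^+ 2 *+ 2) = - u / 8 + - (3 / 8 * u).
  by rewrite xu; field; rewrite s0.
have -> : - x ^+ 2 / ((2 * s) ^+ 2 *+ 2) = - u / 8.
  by rewrite xu; field; rewrite s0.
rewrite expRD xu; set E := expR (- u / 8); set p := normal_peak _.
(* Doubling the standard deviation leaves a spare factor exp(- 3u/8) to absorb [u]; the bound 3
   follows from 1 + y <= exp y at y = 3u/8. The ratio 2 of the peaks times 3 gives the constant
   6. *)
have uE : u * expR (- (3 / 8 * u)) <= 3.
  rewrite expRN ler_pdivrMr ?expR_gt0//.
  have := expR_ge1Dx (3 / 8 * u); lra.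
have E0 : 0 <= 2 * s ^+ 2 * p * E.
  by apply: mulr_ge0; rewrite ?expR_ge0// mulr_ge0 ?normal_peak_ge0// mulr_ge0 ?sqr_ge0.
have := ler_wpM2l E0 uE.
by congr (_ <= _); ring.
Qed.

Lemma normal_second_moment s : s != 0 ->
  (\int[normal_prob 0 s]_x (x ^+ 2)%:E <= (6 * s ^+ 2)%:E)%E.
Proof.
move=> s0; rewrite (@ge0_integral_density _ _ _ lebesgue _ (normal_pdf 0 s))//.
- rewrite -[leRHS]mule1 -(integral_normal_pdf 0 (2 * s)) -ge0_integralZl//.
  + apply: ge0_le_integral => //.
    * by move=> x _; rewrite -EFinM lee_fin mulr_ge0 ?sqr_ge0 ?normal_pdf_ge0.
    * apply: emeasurable_funM; apply/measurable_EFinP => //.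
      exact: measurable_normal_pdf.
    * apply: emeasurable_funM => //; apply/measurable_EFinP => //.
      exact: measurable_normal_pdf.
    * by move=> x _; rewrite -!EFinM lee_fin sqr_normal_pdf_le.
  + by apply/measurable_EFinP; exact: measurable_normal_pdf.
  + by move=> x _; rewrite lee_fin normal_pdf_ge0.
  + by rewrite lee_fin mulr_ge0 ?sqr_ge0.
- exact: measurable_normal_pdf.
- by move=> x; exact: normal_pdf_ge0.
- by apply/measurable_EFinP.
- by move=> x; rewrite lee_fin sqr_ge0.
Qed.

Lemma ge0_integral_oppr (f : R -> \bar R) :
  measurable_fun setT f -> (forall x, 0 <= f x)%E ->
  (\int[lebesgue]_x f (- x)%R = \int[lebesgue]_x f x)%E.
Proof.
move=> mf f0.
have mN : measurable_fun setT (-%R : measurableTypeR R -> measurableTypeR R).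
  exact: oppr_measurable.
have := @ge0_integral_pushforward _ _ (measurableTypeR R) (measurableTypeR R) R
  _ mN lebesgue setT f measurableT mf (fun x _ => f0 x).
rewrite preimage_setT => <-.
by apply: eq_measure_integral => A mA _; exact: lebesgue_measureN.
Qed.

Lemma normal_prob_symm s (f : R -> \bar R) : s != 0 ->
  measurable_fun setT f -> (forall x, 0 <= f x)%E ->
  (\int[normal_prob 0 s]_x f (- x)%R = \int[normal_prob 0 s]_x f x)%E.
Proof.
move=> s0 mf f0.
have pdfN x : normal_pdf 0 s (- x) = normal_pdf 0 s x.
  by rewrite !normal_pdfE// /normal_fun !subr0 sqrrN.
have mp := measurable_normal_pdf 0 s.
have p0 := @normal_pdf_ge0 R 0 s.
have mN : measurable_fun setT (-%R : R -> R) by exact: oppr_measurable.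
have mfN : measurable_fun setT (fun x : R => f (- x)) by exact: measurableT_comp.
have D := @ge0_integral_density _ (measurableTypeR R) R lebesgue (normal_prob 0 s) _ mp p0 (fun _ _ => erefl).
rewrite (D _ mf f0) (D _ mfN (fun x : R => f0 _)).
rewrite -[RHS]ge0_integral_oppr; first last.
- by move=> x; rewrite mule_ge0// lee_fin.
- by apply: emeasurable_funM => //; apply/measurable_EFinP.
by apply: eq_integral => x _; rewrite pdfN.
Qed.

(* Averaging over x and -x removes the cross term. *)
Lemma normal_quadratic_le s a c : s != 0 ->
  (\int[normal_prob 0 s]_x ((a + c * x) ^+ 2)%:E <=
   (a ^+ 2 + 6 * c ^+ 2 * s ^+ 2)%:E)%E.
Proof.
move=> s0; pose f x := ((a + c * x) ^+ 2)%:E.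
have mf (k : R) : measurable_fun setT (fun x : R => ((a + k * x) ^+ 2)%:E).
  have mk : measurable_fun setT (fun x : R => k * x).
    exact: (@measurable_funM _ _ R setT (cst k) id).
  apply/measurable_EFinP/measurable_funX.
  exact: (@measurable_funD _ _ R setT (cst a) (fun x => k * x)).
have f0 (k x : R) : (0 <= ((a + k * x) ^+ 2)%:E)%E by rewrite lee_fin sqr_ge0.
have mq : measurable_fun setT (fun x : R => ((a ^+ 2)%:E + (c ^+ 2)%:E * (x ^+ 2)%:E)%E).
  have m0 : measurable_fun setT (fun x : R => x ^+ 2) by exact: exprn_measurable.
  have m1 := measurable_funM (measurable_cst (c ^+ 2)) m0.
  have m2 := measurable_funD (measurable_cst (a ^+ 2)) m1.
  by move/measurable_EFinP : m2.
have E : (2%:E * \int[normal_prob 0 s]_x f x = 2%:E *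
  \int[normal_prob 0 s]_x ((a ^+ 2)%:E + (c ^+ 2)%:E * (x ^+ 2)%:E))%E.
  rewrite -[in RHS]ge0_integralZl//; last first.
  - by move=> x _; rewrite adde_ge0 ?mule_ge0 ?lee_fin ?sqr_ge0.
  rewrite (_ : 2%:E * _ = \int[normal_prob 0 s]_x f x + \int[normal_prob 0 s]_x f (- x)%R)%E.
    rewrite -ge0_integralD//.
    - apply: eq_integral => x _; rewrite /f -!(EFinM, EFinD).
      by congr (_%:E); ring.
    - by move=> x _; exact: f0.
    - exact: mf.
    - by move=> x _; exact: f0.
    - rewrite /f; under eq_fun do rewrite mulrN -mulNr; exact: mf.
  rewrite normal_prob_symm//; [|exact: mf|exact: f0].
  by rewrite mule_natl mule2n.

have mx2 : measurable_fun setT (fun x : R => (x ^+ 2)%:E).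
  by apply/measurable_EFinP; exact: exprn_measurable.
have l : (2%:E * \int[normal_prob 0 s]_x f x <=
    2%:E * (a ^+ 2 + 6 * c ^+ 2 * s ^+ 2)%:E)%E.
  rewrite E lee_pmul2l// ge0_integralD//.
  - have -> : (\int[normal_prob 0 s]_x (a ^+ 2)%:E = (a ^+ 2)%:E)%E.
      by rewrite integral_cst//= -[RHS]mule1; congr (_ * _)%E; exact: probability_setT.
    rewrite EFinD leeD2l//.
    rewrite ge0_integralZl//; last first.
    + by rewrite lee_fin sqr_ge0.
    + by move=> x _; rewrite lee_fin sqr_ge0.
    have -> : 6 * c ^+ 2 * s ^+ 2 = c ^+ 2 * (6 * s ^+ 2) by ring.
    rewrite (EFinM (c ^+ 2)) lee_wpmul2l ?lee_fin ?sqr_ge0//.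
    exact: normal_second_moment.
  - by move=> x _; rewrite lee_fin sqr_ge0.
  - by move=> x _; rewrite -EFinM lee_fin mulr_ge0 ?sqr_ge0.
  - exact: emeasurable_funM.
by move: l; rewrite lee_pmul2l.
Qed.

End NormalMoments.

Section Independence.
Context (R : realType) (d : measure_display) (Omega : measurableType d).
Context (P : probability Omega R).

(** The joint law of [Z] and [Y] agrees with the product of the law of [Z] and [N] on rectangles,
    hence everywhere; Tonelli's theorem then integrates out [Y] first. *)
Lemma integral_independent d1 d2 (T1 : measurableType d1)
    (T2 : measurableType d2) (N : probability T2 R)
    (Z : Omega -> T1) (Y : Omega -> T2) (f : T1 * T2 -> \bar R) :
  measurable_fun setT Z -> measurable_fun setT Y ->
  (forall A B, measurable A -> measurable B ->
     P (Z @^-1` A `&` Y @^-1` B) = (P (Z @^-1` A) * N B)%E) ->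
  measurable_fun setT f -> (forall z, 0 <= f z)%E ->
  (\int[P]_w f (Z w, Y w) = \int[P]_w \int[N]_y f (Z w, y))%E.
Proof.
move=> mZ mY ZY mf f0.
have mZY : measurable_fun setT (fun w => (Z w, Y w)) by exact: measurable_fun_pair.
pose Zm := isMeasurableFun.Build _ _ _ _ _ mZ.
pose Z' : {mfun Omega >-> T1} := HB.pack Z Zm.
pose ZYm := isMeasurableFun.Build _ _ _ _ _ mZY.
pose ZY' : {mfun Omega >-> (T1 * T2)%type} := HB.pack (fun w => (Z w, Y w)) ZYm.
transitivity (\int[distribution P ZY']_z f z)%E.
  by rewrite ge0_integral_distribution.
transitivity (\int[distribution P Z' \x N]_z f z)%E.
  apply: eq_measure_integral => A mA _; apply/esym.
  exact: (@product_measure_unique _ _ _ _ _ (distribution P Z') N (distribution P ZY')).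
rewrite fubini_tonelli1//; apply: (ge0_integral_distribution Z').
- exact: measurable_fun_fubini_tonelli_F.
- by move=> x; exact: integral_ge0.
Qed.

(** The pair [(X, xi)] is [G]-measurable and so independent of [Y]. It can be frozen while [Y] is
    integrated, and [normal_quadratic_le] applies to each frozen value. *)
Lemma independent_increment_moment (G : set (set Omega)) (X xi : Omega -> R)
    (Y : Omega -> R) (s : R) :
  s != 0 -> sigma_algebra setT G -> G `<=` measurable ->
  wrt_sigma_algebra G X -> wrt_sigma_algebra G xi -> measurable_fun setT Y ->
  (forall A B, G A -> measurable B ->
     P (A `&` Y @^-1` B) = (P A * normal_prob 0 s B)%E) ->
  (\int[P]_w ((X w + xi w * Y w) ^+ 2)%:E <=
   \int[P]_w ((X w) ^+ 2 + 6 * (xi w) ^+ 2 * s ^+ 2)%:E)%E.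
Proof.
move=> s0 sG Gm GX Gxi mY GY.
have mG (f : Omega -> R) : wrt_sigma_algebra G f -> measurable_fun setT f.
  by move=> Gf _ B mB; rewrite setTI; exact/Gm/Gf.
have mX := mG _ GX; have mxi := mG _ Gxi.
pose Z w := (X w, xi w).
have mZ : measurable_fun setT Z by exact: measurable_fun_pair.
have GZ : measurable_fun setT (Z : g_sigma_algebraType G -> R * R).
  by apply: measurable_fun_pair; exact/wrt_sigma_algebraP.
pose f (z : (R * R) * measurableTypeR R) := ((z.1.1 + z.1.2 * z.2) ^+ 2)%:E.
have m11 : measurable_fun setT (fun z : (R * R) * measurableTypeR R => z.1.1).
  exact: measurableT_comp.
have m12 : measurable_fun setT (fun z : (R * R) * measurableTypeR R => z.1.2).
  exact: measurableT_comp.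
have m2 : measurable_fun setT (fun z : (R * R) * measurableTypeR R => z.2 : R).
  exact: measurable_snd.
have mf : measurable_fun setT f.
  apply/measurable_EFinP/measurable_funX.
  pose T := ((R * R) * measurableTypeR R)%type.
  exact: (@measurable_funD _ T R _ _ _ m11 (@measurable_funM _ T R _ _ _ m12 m2)).
have f0 z : (0 <= f z)%E by rewrite lee_fin sqr_ge0.
rewrite (@integral_independent _ _ _ (measurableTypeR R) (normal_prob 0 s) Z Y f)//; last first.
  move=> A B mA mB; apply: GY => //.
  have := GZ measurableT A mA; rewrite setTI.
  by rewrite -[X in _ -> X _](sigma_algebra_id sG).
apply: ge0_le_integral => //.
- by move=> w _; exact: integral_ge0.
- have mF : measurable_fun setT (fubini_F (normal_prob 0 s) f).
    exact: measurable_fun_fubini_tonelli_F.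
  exact: (measurableT_comp mF mZ).
- apply/measurable_EFinP/measurable_funD; first exact: measurable_funX.
  apply: measurable_funM => //; apply: measurable_funM => //.
  exact: measurable_funX.
- by move=> w _; exact: normal_quadratic_le.
Qed.

End Independence.

(** * Elementary integrals *)

Section ElementaryIntegrals.
Context (R : realType) (d : measure_display) (Omega : measurableType d).
Context (P : probability Omega R) (TT : set R) (F : R -> set (set Omega)).
Hypothesis hF : filtration TT F.
Variable B : Omega -> R -> R.
Hypothesis Bad : adapted TT F B.
Hypothesis Binc : forall s t, TT s -> TT t -> s < t ->
  forall A C, F s A -> measurable C ->
  P (A `&` [set w | C (B w t - B w s)]) =
  (P A * normal_prob 0 (Num.sqrt (t - s)) C)%E.

Lemma filtration_measurable t (f : Omega -> R) :
  TT t -> wrt_sigma_algebra (F t) f -> measurable_fun setT f.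
Proof.
by move=> tT Ff _ C mC; rewrite setTI; apply: (hF.1 t tT).2; exact: Ff.
Qed.

Lemma wrt_filtration_le s t (f : Omega -> R) : TT s -> TT t -> s <= t ->
  wrt_sigma_algebra (F s) f -> wrt_sigma_algebra (F t) f.
Proof. by move=> sT tT st Ff C mC; apply: (hF.2 s t) => //; exact: Ff. Qed.

Lemma wrt_filtrationP t (f : Omega -> R) : TT t ->
  wrt_sigma_algebra (F t) f <->
  measurable_fun setT (f : g_sigma_algebraType (F t) -> R).
Proof. by move=> tT; apply: wrt_sigma_algebraP; have [] := hF.1 t tT. Qed.

Variable (n : nat) (u : nat -> R) (c : nat -> Omega -> R).
Hypothesis uT : forall i, (i <= n)%N -> TT (u i).
Hypothesis u_le : forall i, (i < n)%N -> u i <= u i.+1.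
Hypothesis cF : forall i, (i < n)%N -> wrt_sigma_algebra (F (u i)) (c i).

Let sum_incr (a : nat -> Omega -> R) m w :=
  \sum_(i < m) a i w * (B w (u i.+1) - B w (u i)).
Let sum_sqr (a : nat -> Omega -> R) m w :=
  \sum_(i < m) a i w ^+ 2 * (u i.+1 - u i).

Lemma knots_le i j : (i <= j)%N -> (j <= n)%N -> u i <= u j.
Proof.
elim: j => [|j IH]; first by rewrite leqn0 => /eqP ->.
rewrite leq_eqVlt => /orP[/eqP -> //|ij] jn.
by apply: (le_trans (IH ij (ltnW jn))); exact: u_le.
Qed.

Section FixedCoefficients.
Variable a : nat -> Omega -> R.
Hypothesis aF : forall i, (i < n)%N -> wrt_sigma_algebra (F (u i)) (a i).

Lemma wrt_sum_incr m : (m <= n)%N -> wrt_sigma_algebra (F (u m)) (sum_incr a m).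
Proof.
move=> mn; apply/wrt_filtrationP; first exact: uT.
apply: measurable_sum => i.
have im : (i < n)%N := leq_trans (ltn_ord i) mn.
have TBm j : (j <= m)%N -> measurable_fun setT
    (B ^~ (u j) : g_sigma_algebraType (F (u m)) -> R).
  move=> jm; apply/wrt_filtrationP; first exact: uT.
  apply: (@wrt_filtration_le (u j)); [|exact: uT|exact: knots_le|].
    by apply: uT; exact: leq_trans mn.
  by apply: Bad; apply: uT; exact: leq_trans mn.
apply: measurable_funM; last first.
  by apply: measurable_funB; apply: TBm; rewrite // ltnW.
apply/wrt_filtrationP; first exact: uT.
apply: (@wrt_filtration_le (u i)); [|exact: uT| |exact: aF].
  by apply: uT; rewrite ltnW.
by apply: knots_le => //; rewrite ltnW.
Qed.

(** Interval lengths are deterministic, so the quadratic sum including term [m] is known at [u m],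
    the start of its interval. This predictability keeps the truncated coefficients of the tail
    bound adapted. *)
Lemma wrt_sum_sqr m : (m < n)%N -> wrt_sigma_algebra (F (u m)) (sum_sqr a m.+1).
Proof.
move=> mn; have mT : TT (u m) by apply: uT; rewrite ltnW.
apply/wrt_filtrationP => //.
apply: measurable_sum => i; apply: measurable_funM => //; apply: measurable_funX.
have im : (i <= m)%N by rewrite -ltnS.
have iln : (i < n)%N := leq_ltn_trans im mn.
apply/wrt_filtrationP => //.
apply: (@wrt_filtration_le (u i)); [|by []| |exact: aF].
  by apply: uT; rewrite ltnW.
by apply: knots_le => //; rewrite ltnW.
Qed.

Lemma measurable_sum_incr m : (m <= n)%N -> measurable_fun setT (sum_incr a m).
Proof.
by move=> mn; apply: (@filtration_measurable (u m)); [exact: uT|exact: wrt_sum_incr].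
Qed.

Lemma measurable_sum_sqr m : (m <= n)%N -> measurable_fun setT (sum_sqr a m).
Proof.
case: m => [|m] mn.
  rewrite (_ : sum_sqr a 0 = cst 0); first exact: measurable_cst.
  by apply/funext => w; rewrite /sum_sqr big_ord0.
apply: (@filtration_measurable (u m)); last exact: wrt_sum_sqr.
by apply: uT; rewrite ltnW.
Qed.

Lemma sum_sqr_ge0 m w : (m <= n)%N -> 0 <= sum_sqr a m w.
Proof.
move=> mn; apply: sumr_ge0 => i _; rewrite mulr_ge0 ?sqr_ge0// subr_ge0.
by apply: u_le; exact: leq_trans mn.
Qed.

(** The upper half of the Ito isometry, up to the factor 6. In the induction, the new term is a
    coefficient known at [u m] times an increment independent of [F (u m)]. *)
Lemma elementary_integral_moment m : (m <= n)%N ->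
  (\int[P]_w (sum_incr a m w ^+ 2)%:E <= \int[P]_w (6 * sum_sqr a m w)%:E)%E.
Proof.
elim: m => [|m IH] mn.
  apply: ge0_le_integral => //.
  - by move=> w _; rewrite lee_fin sqr_ge0.
  - by apply/measurable_EFinP/measurable_funX; exact: measurable_sum_incr.
  - by apply/measurable_EFinP/measurable_funM => //; exact: measurable_sum_sqr.
  - by move=> w _; rewrite /sum_incr /sum_sqr !big_ord0 mulr0 expr0n.
have mT : TT (u m) by apply: uT; rewrite ltnW.
have m1T : TT (u m.+1) by exact: uT.
have mam : measurable_fun setT (a m).
  by apply: (@filtration_measurable (u m)) => //; exact: aF.
have incrS w : sum_incr a m.+1 w =
    sum_incr a m w + a m w * (B w (u m.+1) - B w (u m)).
  by rewrite /sum_incr big_ord_recr.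
have sqrS w : sum_sqr a m.+1 w = sum_sqr a m w + a m w ^+ 2 * (u m.+1 - u m).
  by rewrite /sum_sqr big_ord_recr.
have mX := measurable_sum_incr (ltnW mn).
have mQ := measurable_sum_sqr (ltnW mn).
have : u m <= u m.+1 by exact: u_le.
(* Coinciding knots add nothing to either sum. They are treated apart because the law of an
   increment is given only for strictly ordered times. *)
rewrite le_eqVlt => /predU1P[uE|ult].
  under eq_integral do rewrite incrS -uE subrr mulr0 addr0.
  under [leRHS]eq_integral do rewrite sqrS -uE subrr mulr0 addr0.
  by apply: IH; exact: ltnW.
have s0 : Num.sqrt (u m.+1 - u m) != 0 by rewrite gt_eqF// sqrtr_gt0 subr_gt0.
have [sF Fm] := hF.1 (u m) mT.
have mdB : measurable_fun setT (fun w => B w (u m.+1) - B w (u m)).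
  apply: measurable_funB.
  - by apply: (@filtration_measurable (u m.+1)) => //; exact: Bad.
  - by apply: (@filtration_measurable (u m)) => //; exact: Bad.
have := @independent_increment_moment _ _ _ P _ _ _ _ _ s0 sF Fm
  (wrt_sum_incr (ltnW mn)) (aF mn) mdB (Binc mT m1T ult).
under eq_integral do rewrite -incrS.
move=> /le_trans; apply.
rewrite sqr_sqrtr ?subr_ge0 ?(ltW ult)//.
under eq_integral do rewrite EFinD.
under [leRHS]eq_integral do rewrite sqrS mulrDr mulrA EFinD.
have ma2 : measurable_fun setT (fun w => 6 * a m w ^+ 2 * (u m.+1 - u m)).
  apply: measurable_funM => //; apply: measurable_funM => //.
  exact: measurable_funX.
have a20 w : 0 <= 6 * a m w ^+ 2 * (u m.+1 - u m).
  by rewrite mulr_ge0 ?subr_ge0 ?(ltW ult)// mulr_ge0// sqr_ge0.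
rewrite !ge0_integralD//.
- by rewrite leeD2r//; apply: IH; exact: ltnW.
- by move=> w _; rewrite lee_fin mulr_ge0// sum_sqr_ge0// ltnW.
- by apply/measurable_EFinP/measurable_funM.
- by move=> w _; rewrite lee_fin.
- exact/measurable_EFinP.
- by move=> w _; rewrite lee_fin sqr_ge0.
- by apply/measurable_EFinP/measurable_funX.
- by move=> w _; rewrite lee_fin.
- exact/measurable_EFinP.
Qed.

End FixedCoefficients.

(* Lenglart: stop adding terms once the quadratic sum exceeds delta. *)
Lemma elementary_integral_tail (delta e : R) : 0 < delta -> 0 < e ->
  (P [set w | (e < `|sum_incr c n w|)%R] <=
   P [set w | (delta < sum_sqr c n w)%R] + (6 * delta / e ^+ 2)%:E)%E.
Proof.
move=> delta0 e0.
(* The test includes term [i] itself (hence [i.+1]), so the truncated quadratic sum never overshoots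
   [delta]; it is still decided at time [u i]. *)
pose a i w := if sum_sqr c i.+1 w <= delta then c i w else 0.
have aF i : (i < n)%N -> wrt_sigma_algebra (F (u i)) (a i).
  move=> iln; have iT : TT (u i) by apply: uT; rewrite ltnW.
  apply/wrt_filtrationP => //; apply: measurable_fun_ifT => //.
    apply: measurable_fun_ler => //.
    by apply/wrt_filtrationP => //; exact: wrt_sum_sqr.
  by apply/wrt_filtrationP => //; exact: cF.
have sum_sqr_le i j w : (i <= j)%N -> (j <= n)%N -> sum_sqr c i w <= sum_sqr c j w.
  elim: j => [|j IH]; first by rewrite leqn0 => /eqP ->.
  rewrite leq_eqVlt => /orP[/eqP -> //|ij] jn.
  apply: (le_trans (IH ij (ltnW jn))).
  by rewrite /sum_sqr [leRHS]big_ord_recr /= lerDl mulr_ge0 ?sqr_ge0// subr_ge0 u_le.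
have sum_a m w : (m <= n)%N -> sum_sqr a m w <= delta.
  elim: m => [|m IH] mn; first by rewrite /sum_sqr big_ord0 ltW.
  rewrite /sum_sqr big_ord_recr /= {2}/a; case: ifPn => cd; last first.
    by rewrite expr0n mul0r addr0; apply: IH; exact: ltnW.
  apply: le_trans cd; rewrite /sum_sqr big_ord_recr /= lerD2r.
  apply: ler_sum => i _; rewrite ler_wpM2r ?subr_ge0 ?u_le//.
    exact: leq_trans (ltn_ord i) (ltnW mn).
  by rewrite /a; case: ifP => // _; rewrite expr0n sqr_ge0.
have mIc : measurable_fun setT (sum_incr c n) by exact: measurable_sum_incr.
have mIa : measurable_fun setT (sum_incr a n) by exact: measurable_sum_incr.
have mQc : measurable_fun setT (sum_sqr c n) by exact: measurable_sum_sqr.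
have mset (f : Omega -> R) (k : R) : measurable_fun setT f ->
    measurable [set w | k < f w].
  move=> mf; rewrite (_ : [set w | _] = f @^-1` `]k, +oo[%classic).
    by rewrite -[X in measurable X]setTI; exact: mf.
  by apply/seteqP; split => w /=; rewrite in_itv/= andbT.
have mset_norm (f : Omega -> R) : measurable_fun setT f ->
    measurable [set w | e < `|f w|].
  by move=> mf; apply: mset; exact: measurableT_comp.
(* Quadratic sums grow with the number of terms, so no coefficient is truncated where the full sum
   is at most [delta]. *)
have sub : [set w | e < `|sum_incr c n w|] `<=`
    [set w | delta < sum_sqr c n w] `|` [set w | e < `|sum_incr a n w|].
  move=> w /= ecw; have [dc|cd] := ltP delta (sum_sqr c n w); first by left.
  right; rewrite (_ : sum_incr a n w = sum_incr c n w)//.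
  apply: eq_bigr => i _; rewrite /a ifT//.
  by apply: le_trans cd; exact: sum_sqr_le.
apply: (@le_trans _ _ (P (([set w | delta < sum_sqr c n w] `|`
    [set w | e < `|sum_incr a n w|]) : set Omega)%R)).
  apply: le_measure => //; rewrite inE; first exact: mset_norm.
  by apply: measurableU; [exact: mset|exact: mset_norm].
apply: (le_trans (measureU2 _ (mset _ _ mQc) (mset_norm _ mIa))).
rewrite leeD2l// EFinM lee_pdivlMr ?exprn_gt0//.
(* Chebyshev's inequality for the truncated integral, whose second moment is at most [6 * delta]. *)
apply: (@le_trans _ _ (\int[P]_w (sum_incr a n w ^+ 2)%:E)%E).
  have e20 : 0 < e ^+ 2 by rewrite exprn_gt0.
  have mS : measurable_fun setT (fun w => (sum_incr a n w ^+ 2)%:E).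
    by apply/measurable_EFinP; exact: measurable_funX.
  have := @le_integral_abse _ _ _ P setT measurableT _ _ mS e20.
  under [in leRHS]eq_integral do rewrite gee0_abs ?lee_fin ?sqr_ge0//.
  apply: le_trans; rewrite muleC lee_pmul2l// le_measure// ?inE//.
  - exact: mset_norm.
  - apply: emeasurable_fun_c_infty => //; exact: measurableT_comp.
  - move=> w /= ew; split => //=; rewrite lee_fin ger0_norm ?sqr_ge0//.
    by rewrite -[leRHS](real_normK (num_real _)) ler_pXn2r ?nnegrE// ltW.
apply: (le_trans (elementary_integral_moment aF (leqnn n))).
apply: (@le_trans _ _ (\int[P]_w (cst (6 * delta)%:E w))%E).
  apply: ge0_le_integral => //.
  - by move=> w _; rewrite lee_fin mulr_ge0// sum_sqr_ge0.
  - by apply/measurable_EFinP/measurable_funM => //; exact: measurable_sum_sqr.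
  - by move=> w _; rewrite lee_fin ler_wpM2l// sum_a.
rewrite integral_cst// -[leRHS]mule1; apply: lee_wpmul2l; last exact: probability_le1.
by rewrite lee_fin mulr_ge0// ltW.
Qed.

End ElementaryIntegrals.

(** * The time interval, sections at a fixed scenario, and squares of simple integrands *)

Section TimeInterval.
Context (R : realType) (TT : set R) (hTT : time_interval TT).

Lemma time_ge0 t : TT t -> 0 <= t.
Proof.
by case: hTT => [[T [_ ->]]|->] /=; rewrite in_itv /= ?andbT => // /andP[].
Qed.

Lemma time_le s t : TT t -> 0 <= s -> s <= t -> TT s.
Proof.
case: hTT => [[T [_ ->]]|->] /=; rewrite !in_itv /= ?andbT => // /andP[_ tT] -> /=.
by move=> /le_trans; exact.
Qed.

Lemma time_itv t : TT t -> `[0, t] `<=` TT.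
Proof. by move=> tT s /=; rewrite in_itv /= => /andP[s0 st]; exact: time_le tT _ _. Qed.

Lemma measurable_time : measurable TT.
Proof. by case: hTT => [[T [_ ->]]|->]. Qed.

End TimeInterval.

Section Sections.
Context (R : realType) (d : measure_display) (Omega : measurableType d).
Context (P : probability Omega R) (TT : set R) (hTT : time_interval TT).
Local Notation lebesgue := (@lebesgue_measure R).

(** The product measure of a set is the integral over [Omega] of the measures of its sections, so
    almost all sections of a null set are null. *)
Lemma aeverywhere_sections (Q : Omega -> R -> Prop) : aeverywhere P TT Q ->
  {ae P, forall w, {ae lebesgue, forall t, TT t -> Q w t}}.
Proof.
move=> [M [mM M0 QM]].
have mx : measurable_fun setT (lebesgue \o xsection M) by exact: measurable_fun_xsection.
have : (\int[P]_w `|lebesgue (xsection M w)| = 0)%E.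
  by under eq_integral do rewrite gee0_abs//; exact: M0.
move=> /(ae_eq_integral_abs P measurableT mx).1; apply: filterS => w /(_ I) /= Mw0.
exists (xsection M w); split; [exact: measurable_xsection|exact: Mw0|].
by move=> t /= nQ; rewrite /xsection /= inE; apply: QM.
Qed.

Lemma jointly_measurable_section (X : Omega -> R -> R) w :
  jointly_measurable TT X -> measurable_fun TT (X w).
Proof.
move=> mX.
have mT : measurable (setT `*` TT : set (Omega * R)).
  by apply: measurableX => //; exact: measurable_time.
have := (measurable_restrictT _ mT).1 mX => /(measurable_fun_pair2 w) m.
apply: (eq_measurable_fun _ _ (measurable_funTS m)) => t.
rewrite inE => tT; rewrite patchE mem_set//.
Qed.

End Sections.

Section SimpleIntegrands.
Context (R : realType) (d : measure_display) (Omega : measurableType d).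
Context (TT : set R) (F : R -> set (set Omega)) (hTT : time_interval TT).
Variable h : simple_integrand TT F.
Variable t : R.
Hypothesis tT : TT t.
Local Notation lebesgue := (@lebesgue_measure R).
Local Notation n := (si_steps h).

Definition stopped_knot i := Num.min (si_knot h i) t.

(** If knot [i] lies after [t], its coefficient need not be known at the capped knot [t]. The capped
    interval is then empty, and the value 0 restores adaptedness without changing the integral up to
    [t]. *)
Definition stopped_coef i w : R :=
  if stopped_knot i < stopped_knot i.+1 then si_coef h i w else 0.

Lemma stopped_knot_time i : (i <= n)%N -> TT (stopped_knot i).
Proof.
move=> iln; rewrite /stopped_knot minEle; case: ifP => // _.
exact: si_knot_time.
Qed.

Lemma stopped_knot_le i : (i < n)%N -> stopped_knot i <= stopped_knot i.+1.
Proof.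
by move=> iln; rewrite le_min !ge_min lexx orbT andbT si_knot_le.
Qed.

Lemma stopped_coef_meas i : filtration TT F -> (i < n)%N ->
  wrt_sigma_algebra (F (stopped_knot i)) (stopped_coef i).
Proof.
move=> hF iln; have -> : stopped_coef i =
    if stopped_knot i < stopped_knot i.+1 then si_coef h i else cst 0.
  by apply/funext => w; rewrite /stopped_coef; case: ifP.
case: ifP => [lt|_].
  have -> : stopped_knot i = si_knot h i.
    rewrite /stopped_knot; apply/min_idPl; rewrite leNgt; apply/negP => ti.
    move: lt; rewrite /stopped_knot (min_idPr (ltW ti)).
    by rewrite ltNge ge_min lexx orbT.
  exact: si_coef_meas.
apply/(wrt_filtrationP hF); first by apply: stopped_knot_time; exact: ltnW.
exact: measurable_cst.
Qed.

Lemma si_integral_stopped (B : Omega -> R -> R) w : si_integral B h w t =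
  \sum_(i < n) stopped_coef i w *
    (B w (stopped_knot i.+1) - B w (stopped_knot i)).
Proof.
apply: eq_bigr => i _; rewrite /stopped_coef -/(stopped_knot i.+1) -/(stopped_knot i).
have := stopped_knot_le (ltn_ord i); rewrite le_eqVlt => /predU1P[<-|->//].
by rewrite subrr !mulr0.
Qed.

Lemma stopped_indic i s : s <= t ->
  (\1_(`]si_knot h i, si_knot h i.+1]) s : R) =
  \1_(`]stopped_knot i, stopped_knot i.+1]) s.
Proof.
move=> st; rewrite !indicE; congr (_%:R); congr nat_of_bool.
apply/idP/idP; rewrite !inE /= !in_itv /= /stopped_knot gt_min le_min st andbT.
  by move=> /andP[-> ->].
by rewrite (ltNge t s) st orbF.
Qed.

(** The intervals between successive knots are disjoint, so all cross terms of the square vanish. *)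
Lemma si_process_sqr w s : s <= t -> si_process h w s ^+ 2 =
  \sum_(i < n) stopped_coef i w ^+ 2 *
    \1_(`]stopped_knot i, stopped_knot i.+1]) s.
Proof.
move=> st; pose I (i : nat) := \1_(`]stopped_knot i, stopped_knot i.+1]) s : R.
have II i j : (i < n)%N -> (j < n)%N -> i != j -> I i * I j = 0.
  wlog ij : i j / (i < j)%N.
    move=> H iln jn ij; have [l|l|l] := ltngtP i j; first exact: H.
      by rewrite mulrC H// eq_sym.
    by rewrite l eqxx in ij.
  move=> iln jn _; rewrite /I !indicE.
  have [si|] := boolP (s \in `]stopped_knot i, stopped_knot i.+1]%classic); last by rewrite mul0r.
  have [sj|] := boolP (s \in `]stopped_knot j, stopped_knot j.+1]%classic); last by rewrite mulr0.
  move: si sj; rewrite !inE /= !in_itv /= => /andP[_ s1] /andP[s2 _].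
  have := le_lt_trans s1 (le_lt_trans (knots_le stopped_knot_le ij (ltnW jn)) s2).
  by rewrite ltxx.
have I2 i : I i * I i = I i.
  by rewrite /I indicE; case: (_ \in _); rewrite ?mulr1 ?mulr0.
have -> : si_process h w s = \sum_(i < n) stopped_coef i w * I i.
  apply: eq_bigr => i _; rewrite stopped_indic// /stopped_coef.
  have := stopped_knot_le (ltn_ord i); rewrite le_eqVlt => /predU1P[E|->//].
  rewrite -/(I i) (_ : I i = 0) ?mulr0// /I E indicE.
  by rewrite memNset// => /=; rewrite in_itv /= => /andP[/lt_le_trans/[apply]]; rewrite ltxx.
rewrite expr2 big_distrlr /=; apply: eq_bigr => i _.
rewrite (bigD1 i) //= big1 ?addr0; first by rewrite mulrACA I2 expr2.
by move=> j ji; rewrite mulrACA II ?mulr0// eq_sym.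
Qed.

(** Identifies the quadratic sum of the tail bound with the squared distance of the simple process
    to the zero integrand. *)
Lemma integral_si_process_sqr w :
  (\int[lebesgue]_(s in `[0%R, t]) (si_process h w s ^+ 2)%:E =
   (\sum_(i < n) stopped_coef i w ^+ 2 * (stopped_knot i.+1 - stopped_knot i))%:E)%E.
Proof.
under eq_integral => s.
  rewrite inE /= in_itv /= => /andP[_ st]; rewrite si_process_sqr// -sumEFin.
  over.
rewrite ge0_integral_sum//; last 2 first.
- move=> i; apply/measurable_EFinP/measurable_funM => //.
- by move=> i s _; rewrite lee_fin mulr_ge0 ?sqr_ge0.
rewrite -sumEFin; apply: eq_bigr => i _; rewrite EFinM.
under eq_integral do rewrite EFinM.
rewrite ge0_integralZl//; last 2 first.
- by apply/measurable_EFinP.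
- by rewrite lee_fin sqr_ge0.
congr (_ * _)%E; rewrite integral_indic//.
have si := stopped_knot_le (ltn_ord i).
rewrite setIidl; last first.
  move=> s /=; rewrite !in_itv /= => /andP[s1 s2]; apply/andP; split.
    by apply: le_trans (ltW s1); apply: (time_ge0 hTT); apply: stopped_knot_time; rewrite ltnW.
  by apply: (le_trans s2); rewrite /stopped_knot ge_min lexx orbT.
rewrite /= lebesgue_measure_itv /= lte_fin; case: ltP => // l.
by rewrite (@le_anti _ _ (stopped_knot i.+1) (stopped_knot i)) ?subrr// l si.
Qed.

End SimpleIntegrands.

(** * Integrals of null integrands *)

Section ItoIntegralOfZero.
Context (R : realType) (d : measure_display) (Omega : measurableType d).
Context (P : probability Omega R) (TT : set R) (F : R -> set (set Omega)).
Hypothesis hTT : time_interval TT.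
Hypothesis hP : measure_is_complete P.
Hypothesis hF : filtration TT F.
Local Notation lebesgue := (@lebesgue_measure R).

(** The rational is chosen to the right of [t], unless [t] is the last time; then [t] is positive
    and the rational is chosen to its left. *)
Lemma time_rat_dense t (e : R) : TT t -> 0 < e ->
  exists q : rat, TT (ratr q) /\ `|t - ratr q| < e.
Proof.
move=> tT e0; have [[s [sT ts]]|max] := pselect (exists s, TT s /\ t < s).
  have /rat_in_itvoo[q] : t < Num.min s (t + e) by rewrite lt_min ts ltrDl.
  rewrite in_itv /= lt_min => /andP[tq /andP[qs qe]]; exists q; split.
    apply: (time_le hTT sT); last exact: ltW.
    by apply: le_trans (ltW tq); exact: (time_ge0 hTT).
  by rewrite ltr0_norm ?subr_lt0// opprB ltrBlDl.
have t0 : 0 < t.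
  rewrite lt_neqAle (time_ge0 hTT tT) andbT; apply/eqP => t0; apply: max.
  case: hTT => [[T [T0 TE]]|TE].
    by exists T; rewrite -t0 TE /= in_itv /= lexx ltW.
  by exists 1; rewrite -t0 TE /= in_itv /= ler01 ltr01.
have /rat_in_itvoo[q] : Num.max 0 (t - e) < t by rewrite gt_max t0 gtrBl.
rewrite in_itv /= gt_max => /andP[/andP[q0 eq] qt]; exists q; split.
  by apply: (time_le hTT tT); exact: ltW.
by rewrite gtr0_norm ?subr_gt0// ltrBlDl -ltrBlDr.
Qed.

Lemma within_continuous_eq0 (f : R -> R) : {within TT, continuous f} ->
  (forall q : rat, TT (ratr q) -> f (ratr q) = 0) ->
  forall t, TT t -> f t = 0.
Proof.
move=> /subspace_continuousP cf fq t tT; apply/eqP/negPn/negP => ft0.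
have ft : 0 < `|f t| by rewrite normr_gt0.
have /cvgrPdist_lt/(_ _ ft) := cf t tT.
rewrite near_withinE => /nbhs_ballP[e /= e0 te].
have [q [qT tq]] := time_rat_dense tT e0.
by have := te (ratr q) tq qT; rewrite /from_subspace /= fq// subr0 ltxx.
Qed.

Lemma ae_eq0_of_tails (f : Omega -> R) : measurable_fun setT f ->
  (forall e : R, 0 < e -> P [set w | e < `|f w|] = 0%E) ->
  {ae P, forall w, f w = 0}.
Proof.
move=> mf fe.
have : {ae P, forall w, forall n, `|f w| <= n.+1%:R^-1}.
  apply: ae_foralln => n; exists [set w | n.+1%:R^-1 < `|f w|]; split.
  - rewrite (_ : [set w | _] = (Num.norm \o f) @^-1` `]n.+1%:R^-1, +oo[%classic).
      by rewrite -[X in measurable X]setTI; exact: measurableT_comp.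
    by apply/seteqP; split => w /=; rewrite in_itv/= andbT.
  - by apply: fe; rewrite invr_gt0.
  - by move=> w /= /negP; rewrite -ltNge.
apply: filterS => w fw; apply/eqP; rewrite -normr_le0 leNgt; apply/negP => f0.
have [n _ fn] := near_infty_natSinv_lt (PosNum f0).
by have := fn n (leqnn n); rewrite /= ltNge fw.
Qed.

Variable B : Omega -> R -> R.
Hypothesis Bad : adapted TT F B.
Hypothesis Binc : forall s t, TT s -> TT t -> s < t ->
  forall A C, F s A -> measurable C ->
  P (A `&` [set w | C (B w t - B w s)]) =
  (P A * normal_prob 0 (Num.sqrt (t - s)) C)%E.

(** For almost every scenario [H] vanishes at almost every time, so the squared distance of [h n] to
    [H] is the quadratic sum of [h n], which tends to 0 in probability. The tail bound makes the
    elementary integrals, and hence their limit [Z], small. *)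
Lemma ito_integral_zero_at (H Z : Omega -> R -> R) t : TT t ->
  jointly_measurable TT H -> aeverywhere P TT (fun w t => H w t = 0) ->
  is_scalar_ito_integral P TT F B H Z -> {ae P, forall w, Z w t = 0}.
Proof.
move=> tT mH H0 [Zad _ [h hP2]].
have [hH hZ] := hP2 t tT.
have mZ : measurable_fun setT (Z ^~ t).
  by apply: (@filtration_measurable _ _ _ TT F hF t) => //; exact: Zad.
have [M [mM PM0 HM]] := aeverywhere_sections H0.
apply: ae_eq0_of_tails => // e e0.
have e20 : 0 < e / 2 by rewrite divr_gt0.
set S := [set w | e < `|Z w t|].
have mset (f : Omega -> R) (k : R) : measurable_fun setT f ->
    measurable [set w | k < f w].
  move=> mf; rewrite (_ : [set w | _] = f @^-1` `]k, +oo[%classic).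
    by rewrite -[X in measurable X]setTI; exact: mf.
  by apply/seteqP; split => w /=; rewrite in_itv/= andbT.
have mS : measurable S by apply: mset; exact: measurableT_comp.
pose u n := stopped_knot (h n) t.
pose c n := stopped_coef (h n) t.
pose I n w := si_integral B (h n) w t.
pose Q n w := \sum_(i < si_steps (h n)) c n i w ^+ 2 * (u n i.+1 - u n i).
have uT n i : (i <= si_steps (h n))%N -> TT (u n i) by exact: stopped_knot_time.
have ule n i : (i < si_steps (h n))%N -> u n i <= u n i.+1 by exact: stopped_knot_le.
have cF n i : (i < si_steps (h n))%N -> wrt_sigma_algebra (F (u n i)) (c n i).
  by move=> ilt; exact: stopped_coef_meas.
have mI n : measurable_fun setT (I n).
  have := measurable_sum_incr hF Bad (uT n) (ule n) (cF n) (leqnn _).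
  by congr measurable_fun; apply/funext => w; rewrite /I si_integral_stopped.
have mQ n : measurable_fun setT (Q n).
  exact: (measurable_sum_sqr hF (uT n) (ule n) (cF n) (leqnn _)).
pose A n (k : R) := [set w | (k%:E < `|\int[lebesgue]_(s in `[0%R, t])
            ((si_process (h n) w s - H w s) ^+ 2)%R%:E|)%E].
have AE n w k : ~ M w -> A n k w <-> k < Q n w.
  move=> nMw.
  have HE : {ae lebesgue, forall s, TT s -> H w s = 0}.
    by apply: contrapT => /HM.
  rewrite /A /= (_ : integral _ _ _ = (Q n w)%:E); last first.
    rewrite -(integral_si_process_sqr hTT (h n) tT w).
    have m1 : measurable_fun `[0, t] (si_process (h n) w).
      apply: measurable_sum => i; apply: measurable_funM => //.
    have m2 : measurable_fun `[0, t] (H w).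
      apply: (@measurable_funS _ _ _ _ TT); first exact: measurable_time.
        exact: time_itv.
      exact: jointly_measurable_section.
    apply: ge0_ae_eq_integral => //.
    - by apply/measurable_EFinP/measurable_funX; exact: measurable_funB.
    - by apply/measurable_EFinP/measurable_funX.
    - by move=> s _; rewrite lee_fin sqr_ge0.
    - by move=> s _; rewrite lee_fin sqr_ge0.
    move: HE; apply: filterS; first exact: (ae_filter_ringOfSetsType lebesgue).
    move=> s Hs /(time_itv hTT tT) sT.
    by rewrite Hs// subr0.
  by rewrite gee0_abs ?lte_fin// lee_fin; exact: (sum_sqr_ge0 (ule n) _ _ (leqnn _)).
(* The two events agree only off the null set [M]; completeness of [P] makes the part of [A n k]
   inside [M] measurable. *)
have PA n k : measurable (A n k) /\ P (A n k) = P [set w | k < Q n w].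
  have AQ : A n k = ([set w | k < Q n w] `\` M) `|` (A n k `&` M).
    apply/seteqP; split => w.
      have [Mw Aw|Mw Aw] := pselect (M w); first by right.
      by left; split => //; apply/AE.
    by case=> -[//] + Mw => /(AE _ _ _ Mw).
  have N : P.-negligible (A n k `&` M) by exists M; split => // w [].
  have mN := hP N.
  have mQk := mset _ k (mQ n).
  have mA : measurable (A n k).
    by rewrite AQ; apply: measurableU => //; exact: measurableD.
  split => //.
  have le1 (X Y : set Omega) : measurable X -> measurable Y ->
      X `<=` Y `|` M -> (P X <= P Y)%E.
    move=> mX mY XY; rewrite -[leRHS]adde0 -PM0.
    apply: le_trans (measureU2 _ mY mM); apply: le_measure => //; rewrite inE//.
    exact: measurableU.
  apply/eqP; rewrite eq_le !le1// => w Xw.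
    by have [Mw|Mw] := pselect (M w); [right|left; exact/AE].
  by have [Mw|Mw] := pselect (M w); [right|left; exact/AE].
have bound delta : 0 < delta -> (P S <= (6 * delta / (e / 2) ^+ 2)%:E)%E.
  move=> delta0.
  have cvA : P (A n delta) @[n --> \oo] --> (0 : \bar R) by exact: hH.
  pose D n := [set w | e / 2 < `|I n w - Z w t|].
  have cvD : P (D n) @[n --> \oo] --> (0 : \bar R) by exact: (hZ _ e20).
  have mD n : measurable (D n).
    by apply: mset; apply: measurableT_comp => //; exact: measurable_funB.
  set k := (_ / _)%:E.
  (* If [Z] exceeds [e] in absolute value, then the elementary integral or its distance to [Z]
     exceeds [e / 2]. The resulting bound on [P S] holds for every [n] and tends to [k]. *)
  have : (P (D n) + (P (A n delta) + k))%E @[n --> \oo] --> (0 + (0 + k))%E.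
    by apply: cvgeD => //; apply: cvgeD => //; exact: cvg_cst.
  rewrite !add0e; apply: cvge_ge; apply: nearW => n.
  rewrite (PA n delta).2.
  have mIn : measurable [set w | e / 2 < `|I n w|].
    by apply: mset; exact: measurableT_comp.
  apply: (@le_trans _ _ (P (D n `|` [set w | e / 2 < `|I n w|]))).
    apply: le_measure; rewrite ?inE//; first exact: measurableU.
    move=> w /=; rewrite /S /= => eZ.
    have [l|l] := ltP (e / 2) `|I n w|; first by right.
    left; rewrite /D /=.
    have := ler_distD (I n w) 0 (Z w t); rewrite !sub0r !normrN => tri.
    have := lt_le_trans eZ tri; move: l; set a := `|I n w|; set b := `|_ - _|.
    lra.
  apply: (le_trans (measureU2 _ (mD n) mIn)); rewrite leeD2l//.
  have := elementary_integral_tail hF Bad Binc (uT n) (ule n) (cF n) delta0 e20.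
  by under [X in P X]eq_set do rewrite -si_integral_stopped.
apply/eqP; rewrite eq_le measure_ge0 andbT.
apply/lee_addgt0Pr => x x0; rewrite add0e.
(* This [delta] turns the bound into the arbitrary positive number [x]. *)
have := bound (x * (e / 2) ^+ 2 / 6).
have -> : 6 * (x * (e / 2) ^+ 2 / 6) / (e / 2) ^+ 2 = x.
  by field; rewrite gt_eqF.
apply.
by rewrite divr_gt0// mulr_gt0// exprn_gt0.
Qed.

(** The exceptional sets at the countably many rational times are merged, and continuity of the
    paths extends the identity to all times. *)
Lemma ito_integral_zero (H Z : Omega -> R -> R) :
  jointly_measurable TT H -> aeverywhere P TT (fun w t => H w t = 0) ->
  is_scalar_ito_integral P TT F B H Z ->
  as_all_times P TT (fun w t => Z w t = 0).
Proof.
move=> mH H0 HZ; have [_ Zc _] := HZ.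
have : {ae P, forall w, forall n : nat,
    forall q : rat, unpickle n = Some q -> TT (ratr q) -> Z w (ratr q) = 0}.
  apply: ae_foralln => n; case: (unpickle n) => [q|]; last first.
    by apply: aeW => w.
  have [qT|qT] := pselect (TT (ratr q)); last by apply: aeW => w q' [<-].
  apply: filterS (ito_integral_zero_at qT mH H0 HZ) => w Zq q' [<-] _.
  exact: Zq.
move=> Zq; apply: filterS2 Zc Zq => w Zw Zq t tT.
apply: (within_continuous_eq0 Zw _ tT) => q qT.
by apply: (Zq (pickle q)) => //; rewrite pickleK.
Qed.

End ItoIntegralOfZero.

(** * Drift of the money market account *)

Section Differentiation.
Context (R : realType).
Local Notation lebesgue := (@lebesgue_measure R).

Lemma near_eq_is_derive (f g : R -> R) (x a : R) :
  {near x, f =1 g} -> is_derive x 1 f a -> is_derive x 1 g a.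
Proof.
move=> fg [df <-]; split; first exact: near_eq_derivable df.
by apply/esym/near_eq_derive.
Qed.

(** Lebesgue's differentiation theorem for [f] extended by 0 outside [[0, T]]. Near an interior
    point the extension does not affect the integral. *)
Lemma ae_is_derive_integral (f : R -> R) (T : R) : 0 < T ->
  lebesgue.-integrable `[0, T] (EFin \o f) ->
  {ae lebesgue, forall x, 0 < x -> x < T ->
    is_derive x 1 (fun y : R => \int[lebesgue]_(s in `[0, y]) f s) (f x)}.
Proof.
move=> T0 If.
pose g := f \_ `[0, T].
have Ig y : lebesgue.-integrable `[0, y] (EFin \o g).
  rewrite (_ : EFin \o g = (EFin \o f) \_ `[0, T]); last first.
    by apply/funext => x; rewrite /g /= !patchE; case: ifP.
  apply/integrable_restrict => //; apply: integrableS If => //.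
    exact: measurableI.
have Lg : locally_integrable [set: R] g by exact: integrable_locally.
have := @FTC1 R g (BLeft 0) Ig Lg.
apply: filterS; first exact: (ae_filter_ringOfSetsType lebesgue).
move=> x Hx x0 xT.
have [dG GE] : derivable (fun y : R => \int[lebesgue]_(s in `[0, y]) g s) x 1 /\
    (fun y : R => \int[lebesgue]_(s in `[0, y]) g s)^`()%classic x = g x.
  by apply: Hx; rewrite lte_fin.
have gx : g x = f x by rewrite /g patchE mem_set//= in_itv /= !ltW.
rewrite -gx -GE derive1E; apply: near_eq_is_derive (derivableP dG).
near=> y; apply: eq_Rintegral => s; rewrite inE /= in_itv /= => /andP[s0 sy].
rewrite /g patchE mem_set//= in_itv /= s0 /= (le_trans sy)// ltW//.
by near: y; exact: lt_nbhsl.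
Unshelve. all: by end_near. Qed.

(** The two sides of the identity agree near each interior point, so their derivatives agree there;
    the right-hand one comes from the chain rule. *)
Lemma ae_exp_integral_derive (f g : R -> R) (m T : R) : 0 < T ->
  lebesgue.-integrable `[0, T] (EFin \o f) ->
  lebesgue.-integrable `[0, T] (EFin \o g) ->
  (forall t, 0 <= t -> t <= T -> m + \int[lebesgue]_(s in `[0, t]) f s =
     m * expR (\int[lebesgue]_(s in `[0, t]) g s)) ->
  {ae lebesgue, forall x, 0 < x -> x < T ->
    f x = g x * (m * expR (\int[lebesgue]_(s in `[0, x]) g s))}.
Proof.
move=> T0 If Ig E.
have Df := ae_is_derive_integral T0 If; have Dg := ae_is_derive_integral T0 Ig.
apply: (@filterS2 _ _ (ae_filter_ringOfSetsType lebesgue) _ _ _ _ Df Dg).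
move=> x Fx Gx x0 xT; have dF := Fx x0 xT; have dG := Gx x0 xT.
set G := fun y : R => \int[lebesgue]_(s in `[0, y]) g s.
have dE : is_derive x 1 (expR \o G) (expR (G x) * g x).
  by apply: is_derive1_comp; exact: is_derive_expR.
have dmE : is_derive x 1 (m \*: (expR \o G)) (m *: (expR (G x) * g x)).
  exact: is_deriveZ.
have dmF : is_derive x 1 (cst m + fun y : R => \int[lebesgue]_(s in `[0, y]) f s) (0 + f x).
  exact: is_deriveD.
have near_eq : {near x, (cst m + fun y : R => \int[lebesgue]_(s in `[0, y]) f s) =1
    m \*: (expR \o G)}.
  near=> y; apply: E; apply: ltW.
    by near: y; exact: lt_nbhsr.
  by near: y; exact: lt_nbhsl.
have [_ e1] := near_eq_is_derive near_eq dmF.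
have [_ e2] := dmE.
by move: e1; rewrite e2 add0r => <-; rewrite -[LHS]/(m * (expR (G x) * g x)) /G; ring.
Unshelve. all: by end_near. Qed.

End Differentiation.

(** * Almost everywhere statements on scenarios and times *)

Section AlmostEverywhere.
Context (R : realType) (d : measure_display) (Omega : measurableType d).
Context (P : probability Omega R) (TT : set R) (hTT : time_interval TT).
Local Notation lebesgue := (@lebesgue_measure R).

(** Endpoints of the time interval form a null set, and an infinite horizon is exhausted by the
    intervals from 0 to n + 1. *)
Lemma ae_exp_integral_derive_time (f g : R -> R) (m : R) :
  (forall t, TT t -> lebesgue.-integrable `[0, t] (EFin \o f)) ->
  (forall t, TT t -> lebesgue.-integrable `[0, t] (EFin \o g)) ->
  (forall t, TT t -> m + \int[lebesgue]_(s in `[0, t]) f s =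
     m * expR (\int[lebesgue]_(s in `[0, t]) g s)) ->
  {ae lebesgue, forall t, TT t ->
    f t = g t * (m * expR (\int[lebesgue]_(s in `[0, t]) g s))}.
Proof.
move=> If Ig E; set e := fun t : R => m * expR (\int[lebesgue]_(s in `[0, t]) g s).
have ae1 T : TT T -> 0 < T ->
    {ae lebesgue, forall t, 0 < t -> t < T -> f t = g t * e t}.
  move=> TTT T0; apply: ae_exp_integral_derive => //; [exact: If|exact: Ig|].
  by move=> t t0 tT; apply: E; exact: (time_le hTT TTT).
have ne a : {ae lebesgue, forall t, t <> a}.
  exists [set a]; split => //; first exact: lebesgue_measure_set1.
  by move=> t /= /contrapT.
case: hTT => [[T [T0 TE]]|TE].
- have TTT : TT T by rewrite TE /= in_itv /= lexx ltW.
  have := @filterI _ _ (ae_filter_ringOfSetsType lebesgue) _ _ (ne 0) (ne T).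
  apply: (@filterS2 _ _ (ae_filter_ringOfSetsType lebesgue) _ _ _ _ (ae1 T TTT T0)).
  move=> t ft [t0 tT]; rewrite TE /= in_itv /= => /andP[t0' tT'].
  apply: ft; rewrite lt_neqAle ?t0' ?tT' andbT; apply/eqP => //.
  by move=> /esym.
- have TTn n : TT n.+1%:R by rewrite TE /= in_itv /= ler0n.
  have := @ae_foralln _ _ _ lebesgue _ (fun n => ae1 _ (TTn n) (ltr0Sn _ n)).
  apply: (@filterS2 _ _ (ae_filter_ringOfSetsType lebesgue) _ _ _ _ (ne 0)).
  move=> t t0 ft; rewrite TE /= in_itv /= andbT => t0'.
  apply: (ft (Num.truncn t)); first by rewrite lt_neqAle t0' andbT; apply/eqP => /esym.
  exact: truncnS_gt.
Qed.

Lemma aeverywhereS (Q1 Q2 : Omega -> R -> Prop) :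
  (forall w t, TT t -> Q1 w t -> Q2 w t) ->
  aeverywhere P TT Q1 -> aeverywhere P TT Q2.
Proof.
move=> Q12 [M [mM M0 QM]]; exists M; split => // z nQ2.
by apply: QM => Q1z; apply: nQ2 => tT; apply: Q12 => //; exact: Q1z.
Qed.

Lemma aeverywhereI (Q1 Q2 : Omega -> R -> Prop) :
  aeverywhere P TT Q1 -> aeverywhere P TT Q2 ->
  aeverywhere P TT (fun w t => Q1 w t /\ Q2 w t).
Proof.
move=> [M [mM M0 QM]] [M' [mM' M0' QM']]; exists (M `|` M'); split.
- exact: measurableU.
- by apply: null_set_setU.
- move=> z /= nQ; have [Mz|Mz] := pselect (M z); [by left|right].
  apply: QM' => Q2z; apply: nQ => tT; split; last exact: Q2z.
  by apply: contrapT => nQ1; apply: Mz; apply: QM => /(_ tT).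
Qed.

(** The way back from sections to the product: joint measurability makes the set of disagreement
    measurable, and its measure is the integral of those of its null sections. *)
Lemma aeverywhere_eq (X Y : Omega -> R -> R) :
  jointly_measurable TT X -> jointly_measurable TT Y ->
  {ae P, forall w, {ae lebesgue, forall t, TT t -> X w t = Y w t}} ->
  aeverywhere P TT (fun w t => X w t = Y w t).
Proof.
move=> mX mY XY.
have mT : measurable (setT `*` TT : set (Omega * R)).
  by apply: measurableX => //; exact: measurable_time.
pose N := (setT `*` TT) `&` [set z : Omega * R | X z.1 z.2 != Y z.1 z.2].
have mN : measurable N.
  have mfalse : measurable [set false] by [].
  have := measurable_fun_eqr mX mY mT mfalse.
  congr measurable; congr (_ `&` _).
  by apply/seteqP; split => z /=; [move=> ->|case: eqP].
exists N; split => //; last first.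
  by move=> [w t] /= /not_implyP[tT /eqP].
have mx : measurable_fun setT (lebesgue \o xsection N) by exact: measurable_fun_xsection.
transitivity (\int[P]_w `|lebesgue (xsection N w)|)%E.
  by apply: eq_integral => w _; rewrite gee0_abs.
apply/(ae_eq_integral_abs P measurableT mx).
apply: filterS XY => w [M [mM M0 XYM]] _ /=.
apply/eqP; rewrite -measure_le0 -M0 le_measure ?inE//; first exact: measurable_xsection.
move=> t; rewrite /xsection /= inE => -[[_ /= tT] /eqP XYt]; apply: XYM => /=.
by move=> /(_ tT).
Qed.

Lemma as_all_times_aeverywhere (Q : Omega -> R -> Prop) :
  as_all_times P TT Q -> aeverywhere P TT Q.
Proof.
move=> [N [mN N0 QN]]; exists (N `*` setT); split.
- exact: measurableX.
- by rewrite product_measure1E// [X in (X * _)%E]N0 mul0e.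
- move=> [w t] /= /not_implyP[tT nQ]; split => //; apply: QN => /=.
  by move=> /(_ t tT).
Qed.

End AlmostEverywhere.

Section Market.
Context (R : realType) (d : measure_display) (Omega : measurableType d).
Context (P : probability Omega R) (TT : set R) (F : R -> set (set Omega)).
Context (K N : nat) (W : Omega -> R -> 'rV[R]_K).
Hypothesis hTT : time_interval TT.
Hypothesis hP : measure_is_complete P.
Hypothesis hF : filtration TT F.
Hypothesis hW : wiener_process P TT F W.
Local Notation lebesgue := (@lebesgue_measure R).

Lemma wiener_increment k s t : TT s -> TT t -> s < t ->
  forall A C, F s A -> measurable C ->
  P (A `&` [set w | C (entry W 0 k w t - entry W 0 k w s)]) =
  (P A * normal_prob 0 (Num.sqrt (t - s)) C)%E.
Proof.
move=> sT tT st A C FA mC; have [_ _ _ inc] := hW.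
(* The other components are left unconstrained: each contributes the factor 1, the mass of the whole
   line. *)
pose B j := if j == k then C else [set: R].
have mB j : measurable (B j) by rewrite /B; case: ifP.
have := inc s t sT tT st A B FA mB.
rewrite (bigD1 k)//= big1 ?mule1 /B ?eqxx; last first.
  by move=> j /negbTE ->; exact: integral_normal_pdf.
move=> <-; congr (P (A `&` _)); apply/seteqP; split => w /=.
  by move=> Cw j; case: eqP => // ->.
by move=> /(_ k); rewrite eqxx.
Qed.

Lemma ito_integral_of_zero n (H : Omega -> R -> 'M[R]_(n, K)) Z :
  adapted_measurable TT F H -> aeverywhere P TT (fun w t => H w t = 0) ->
  is_ito_integral P TT F W H Z -> as_all_times P TT (fun w t => Z w t = 0).
Proof.
move=> mH H0 [Y [HY ZY]]; have [Wad _ _ _] := hW.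
have Y0 i k : {ae P, forall w, forall t, TT t -> entry Y i k w t = 0}.
  apply: (ito_integral_zero hTT hP hF (Wad k) (@wiener_increment k) (mH i k).2 _ (HY i k)).
  by apply: aeverywhereS H0 => w t _ Hz; rewrite /entry Hz mxE.
have : {ae P, forall w, forall i, forall k, forall t, TT t -> entry Y i k w t = 0}.
  by apply: filter_forall => i; apply: filter_forall => k; exact: Y0.
apply: filterS => w Yw t tT; apply/matrixP => i j.
by rewrite ord1 ZY mxE; apply: big1 => k _; exact: Yw.
Qed.

End Market.

Lemma not_on_positive_measureP (R : realType) (d : measure_display)
    (Omega : measurableType d) (P : probability Omega R) (TT : set R)
    (X : Omega -> R -> R) : time_interval TT -> jointly_measurable TT X ->
  ~ on_positive_measure P TT (fun w t => 0 < X w t) <->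
  aeverywhere P TT (fun w t => X w t <= 0).
Proof.
move=> hTT mX.
have mT : measurable (setT `*` TT : set (Omega * R)).
  by apply: measurableX => //; exact: measurable_time.
set A := [set z : Omega * R | TT z.2 /\ 0 < X z.1 z.2].
have mA : measurable A.
  have := mX mT `]0, +oo[%classic (measurable_itv _).
  congr measurable; apply/seteqP; split => z /=; rewrite in_itv /= andbT.
    by move=> [[]].
  by move=> [].
rewrite /on_positive_measure -/A; split=> [A0|A0].
  exists A; split => //.
    by apply/eqP; rewrite eq_le measure_ge0 andbT leNgt; apply/negP.
  by move=> z /= /not_implyP[tT /negP]; rewrite -ltNge.
move: A0 => [M [mM M0 AM]].
apply/negP; rewrite -leNgt -M0 le_measure ?inE//.
move=> z [tT X0]; apply: AM => /= /(_ tT).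
by rewrite leNgt X0.
Qed.

Section MoneyMarket.
Context (R : realType) (d : measure_display) (Omega : measurableType d).
Context (P : probability Omega R) (TT : set R) (F : R -> set (set Omega)).
Context (K N : nat) (W : Omega -> R -> 'rV[R]_K).
Context (S mu : Omega -> R -> 'cV[R]_N.+1).
Context (sigma : Omega -> R -> 'M[R]_(N.+1, K)).
Context (b : Omega -> R -> 'rV[R]_N.+1) (r : Omega -> R -> R).
Hypothesis hTT : time_interval TT.
Hypothesis hP : measure_is_complete P.
Hypothesis hF : filtration TT F.
Hypothesis hW : wiener_process P TT F W.
Hypothesis hb : money_market_account P TT F W S mu sigma b.
Hypothesis hr : interest_rate_process P TT F (value_process S b) r.
Hypothesis hS : adapted_measurable TT F S.
Local Notation C := (regular_process TT F).
Local Notation lebesgue := (@lebesgue_measure R).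

(* The stochastic part of the value process vanishes, so that the value process
   is both M(0) + int b mu and M(0) exp(int r); differentiate. *)
Lemma money_market_drift : aeverywhere P TT (fun w t =>
  (b w t *m mu w t) 0 0 = r w t * value_process S b w t).
Proof.
have [[bm [_ bmu bsigma] [Z [ZI bE]]] _ bsigma0] := hb.
have [[rad rm rint] rE] := hr.
have Z0 : as_all_times P TT (fun w t => Z w t = 0).
  apply: (ito_integral_of_zero hTT hP hF hW _ bsigma0 ZI).
  by move=> i j; have [] := bsigma i j.
have [_ bmum bmuint] := bmu 0 0.
apply: (aeverywhere_eq hTT bmum).
  have CP := regular_field_closed hF.
  have Cr : C (fun z => r z.1 z.2) by split.
  have [_ _ Cm _] := CP.
  have CM : entrywise C (fun z => b z.1 z.2 *m S z.1 z.2) by exact: entrywise_mul.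
  exact: (Cm _ _ Cr (CM 0 0)).2.
apply: filterS2 (filterI Z0 bE) (filterI bmuint (filterI rint rE)).
move=> w [Zw bw] [bmuw [rw rEw]].
have := @ae_exp_integral_derive_time _ _ hTT
  (fun t => (b w t *m mu w t) 0 0) (r w) (value_process S b w 0) bmuw rw.
have E t : TT t -> value_process S b w 0 +
    \int[lebesgue]_(s in `[0, t]) (b w s *m mu w s) 0 0 =
    value_process S b w 0 * expR (\int[lebesgue]_(s in `[0, t]) r w s).
  move=> tT; rewrite -rEw// /value_process [in RHS]bw// Zw// addr0.
  by rewrite !mxE.
move=> /(_ E); apply: filterS; first exact: (ae_filter_ringOfSetsType lebesgue).
by move=> t H tT; rewrite /entry H// -rEw.
Qed.

End MoneyMarket.

(** * Arbitrage, prices of risk and the residual strategy *)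

Section FundamentalTheorem.
Context (R : realType) (d : measure_display) (Omega : measurableType d).
Context (P : probability Omega R) (TT : set R) (F : R -> set (set Omega)).
Context (K N : nat) (S mu : Omega -> R -> 'cV[R]_N.+1).
Context (sigma : Omega -> R -> 'M[R]_(N.+1, K)).
Context (b : Omega -> R -> 'rV[R]_N.+1) (r : Omega -> R -> R).
Hypothesis hTT : time_interval TT.
Hypothesis hF : filtration TT F.
Local Notation C := (regular_process TT F).
Hypothesis CS : entrywise C (fun z => S z.1 z.2).
Hypothesis Cmu : entrywise C (fun z => mu z.1 z.2).
Hypothesis Csigma : entrywise C (fun z => sigma z.1 z.2).
Hypothesis Cb : entrywise C (fun z => b z.1 z.2).
Hypothesis Cr : C (fun z => r z.1 z.2).

Lemma arbitrage_free_of_prices_of_risk (lambda : Omega -> R -> 'rV[R]_K) :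
  prices_of_risk P TT F S mu sigma r lambda ->
  instantaneously_arbitrage_free P TT F S mu sigma.
Proof.
move=> [_ lE] [Delta [CD Dsigma DS _]].
have CDmu : entrywise C (fun z => Delta z.1 z.2 *m mu z.1 z.2).
  exact: (entrywise_mul (regular_field_closed hF)).
apply/(not_on_positive_measureP P hTT (CDmu 0 0).2).
apply: aeverywhereS (aeverywhereI lE (aeverywhereI Dsigma DS)).
move=> w t _ [/eqP]; rewrite subr_eq => /eqP -> [Dsigma0 DS0].
by rewrite mulmxDr mulmxA Dsigma0 mul0mx add0r -scalemxAr DS0 scaler0 mxE.
Qed.

(* The strategy e^T - (e^T S / M) b built from the residual e of the least
   squares approximation of mu - r S by the columns of sigma has drift |e|^2. *)
Lemma arbitrage_free_projection :
  as_all_times P TT (fun w t => 0 < value_process S b w t) ->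
  aeverywhere P TT (fun w t => b w t *m sigma w t = 0) ->
  aeverywhere P TT (fun w t =>
    (b w t *m mu w t) 0 0 = r w t * value_process S b w t) ->
  instantaneously_arbitrage_free P TT F S mu sigma ->
  exists psi : Omega -> R -> 'rV[R]_N.+1,
    trading_strategy TT F psi /\
    aeverywhere P TT (fun w t => mu w t - r w t *: S w t =
      sigma w t *m (sigma w t)^T *m (psi w t)^T).
Proof.
move=> M0 bsigma bmu free; have CP := regular_field_closed hF.
pose v (z : Omega * R) := mu z.1 z.2 - r z.1 z.2 *: S z.1 z.2.
pose A (z : Omega * R) := sigma z.1 z.2 *m (sigma z.1 z.2)^T.
have Cv : entrywise C v.
  by apply: (entrywise_add CP) => //; apply: (entrywise_opp CP); exact: entrywise_scale.
have CA : entrywise C A by apply: (entrywise_mul CP) => //; exact: entrywise_tr.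
have [x [Cx xP]] := least_squares CP CA Cv.
exists (fun w t => (x (w, t))^T); split.
  have := entrywise_tr Cx; move=> Cxt i j; exact: (Cxt i j).
pose e z := v z - A z *m x z.
have Ce : entrywise C e.
  by apply: (entrywise_add CP) => //; apply: (entrywise_opp CP); exact: entrywise_mul.
have AT z : (A z)^T = A z by rewrite /A trmx_mul trmxK.
have Ae z : A z *m e z = 0 by rewrite -[A z in LHS]AT xP.
(* The squared norm of [sigma^T e] is [e^T A e], which vanishes because [A] is symmetric and [e] is
   orthogonal to its columns. *)
have sigmae z : (sigma z.1 z.2)^T *m e z = 0.
  by apply: mulmx_tr_eq0; rewrite trmx_mul trmxK -mulmxA [sigma _ _ *m _]mulmxA -/(A z) Ae mulmx0.
have esigma z : (e z)^T *m sigma z.1 z.2 = 0.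
  by apply: trmx_inj; rewrite trmx_mul trmxK sigmae trmx0.
pose M z := value_process S b z.1 z.2.
(* The number of units of the money market account, of value [M] each, worth as much as [e^T];
   selling them makes the value of [Delta] zero. *)
pose c z := ((e z)^T *m S z.1 z.2) 0 0 * (M z)^-1.
pose Delta w t := (e (w, t))^T - c (w, t) *: b w t.
have CM : C M by exact: (entrywise_mul CP Cb CS 0 0).
have Cc : C c.
  have [_ _ Cm Ci] := CP; apply: Cm; last exact: Ci.
  exact: (entrywise_mul CP (entrywise_tr Ce) CS 0 0).
have CD : entrywise C (fun z => Delta z.1 z.2).
  have CD' : entrywise C (fun z => (e z)^T - c z *: b z.1 z.2).
    apply: (entrywise_add CP); first exact: entrywise_tr.
    by apply: (entrywise_opp CP); exact: entrywise_scale.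
  move=> i j; have := CD' i j; congr regular_process.
  by apply/funext => -[w t].
have CDmu : entrywise C (fun z => Delta z.1 z.2 *m mu z.1 z.2) by exact: entrywise_mul.
have basic := aeverywhereI (as_all_times_aeverywhere M0) (aeverywhereI bsigma bmu).
have DS w t : 0 < value_process S b w t -> Delta w t *m S w t = 0.
  move=> Mt; apply/matrixP => i j; rewrite !ord1 /Delta mulmxBl -scalemxAl.
  rewrite [LHS]mxE [X in _ + X]mxE [X in _ - X]mxE -[(b w t *m _) 0 0]/(M (w, t)).
  by rewrite /c divfK ?subrr ?mxE// gt_eqF.
have Dmu w t : 0 < value_process S b w t ->
    (b w t *m mu w t) 0 0 = r w t * value_process S b w t ->
    Delta w t *m mu w t = (e (w, t))^T *m e (w, t).
  move=> Mt bmut.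
  (* Since [v = e + A x] and [e] is orthogonal to the columns of [A]. The drift of the part in [b]
     is [c r M = r e^T S], so the drift of [Delta] is [e^T (mu - r S) = e^T v]. *)
  have -> : (e (w, t))^T *m e (w, t) = (e (w, t))^T *m v (w, t).
    have eA : (e (w, t))^T *m A (w, t) = 0.
      by apply: trmx_inj; rewrite trmx_mul trmxK AT Ae trmx0.
    have -> : v (w, t) = e (w, t) + A (w, t) *m x (w, t) by rewrite subrK.
    by rewrite [RHS]mulmxDr [X in _ + X]mulmxA eA mul0mx addr0.
  apply/matrixP => i j; rewrite !ord1 /Delta /v /= mulmxBl mulmxBr -scalemxAl -scalemxAr.
  rewrite [LHS]mxE [RHS]mxE; congr (_ + _).
  rewrite [LHS]mxE [RHS]mxE; congr (- _); rewrite [LHS]mxE [RHS]mxE bmut.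
  by rewrite mulrCA /c divfK// gt_eqF.
have e2 z : 0 <= ((e z)^T *m e z) 0 0.
  by rewrite mxE sumr_ge0// => i _; rewrite mxE -expr2 sqr_ge0.
have : aeverywhere P TT (fun w t => (Delta w t *m mu w t) 0 0 <= 0).
  apply/(not_on_positive_measureP P hTT (CDmu 0 0).2) => pos.
  apply: free; exists Delta; split => //.
  - apply: aeverywhereS basic => w t _ [_ [bs _]].
    by rewrite /Delta mulmxBl (esigma (w, t)) -scalemxAl bs scaler0 subr0.
  - by apply: aeverywhereS basic => w t _ [Mt _]; exact: DS.
  - by apply: aeverywhereS basic => w t _ [Mt [_ bm]]; rewrite Dmu.
(* A nonpositive squared norm forces [e = 0], that is, [v = A x]. *)
move=> /(aeverywhereI basic); apply: aeverywhereS => w t _ [[Mt [_ bm]]].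
rewrite Dmu// => le0; apply/eqP; rewrite trmxK -subr_eq0; apply/eqP.
apply: (@mulmx_tr_eq0 _ _ _ (e (w, t))); apply/matrixP => i j; rewrite !ord1 [RHS]mxE.
by apply/eqP; rewrite eq_le le0 e2.
Qed.

End FundamentalTheorem.

Theorem proposition3 (R : realType) (d : measure_display)
    (Omega : measurableType d) (P : probability Omega R)
    (TT : set R) (F : R -> set (set Omega))
    (K N : nat) (W : Omega -> R -> 'rV[R]_K)
    (S D mu : Omega -> R -> 'cV[R]_N.+1)
    (sigma : Omega -> R -> 'M[R]_(N.+1, K))
    (b : Omega -> R -> 'rV[R]_N.+1) (r : Omega -> R -> R)
    (hTT : time_interval TT)
    (hP : measure_is_complete P)
    (hF : filtration TT F)
    (hW : wiener_process P TT F W)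
    (hSD : securities_market_model P TT F W S D mu sigma)
    (hb : money_market_account P TT F W S mu sigma b)
    (hr : interest_rate_process P TT F (value_process S b) r)
    (hD : calL P TT F W (vec1 (fun w t => (value_process S b w t)^-1)) D) :
  (instantaneously_arbitrage_free P TT F S mu sigma <->
     exists lambda : Omega -> R -> 'rV[R]_K,
       prices_of_risk P TT F S mu sigma r lambda) /\
  (instantaneously_arbitrage_free P TT F S mu sigma <->
     exists psi : Omega -> R -> 'rV[R]_N.+1,
       trading_strategy TT F psi /\
       aeverywhere P TT (fun w t =>
         mu w t - r w t *: S w t
           = sigma w t *m (sigma w t)^T *m (psi w t)^T)).
Proof.
have [hS _ _ [_ hmu hsigma _]] := hSD.
have [[hbm _ _] bpos bsigma] := hb.
have [[rad rm _] _] := hr.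
have Cmu : entrywise (regular_process TT F) (fun z => mu z.1 z.2).
  by move=> i j; have [] := hmu i j.
have Csigma : entrywise (regular_process TT F) (fun z => sigma z.1 z.2).
  by move=> i j; have [] := hsigma i j.
have Cr : regular_process TT F (fun z => r z.1 z.2) by split.
have bmu := money_market_drift hTT hP hF hW hb hr hS.
have free_psi :=
  arbitrage_free_projection hTT hF hS Cmu Csigma hbm Cr bpos bsigma bmu.
have psi_lambda psi : trading_strategy TT F psi ->
    aeverywhere P TT (fun w t => mu w t - r w t *: S w t =
      sigma w t *m (sigma w t)^T *m (psi w t)^T) ->
    prices_of_risk P TT F S mu sigma r (fun w t => psi w t *m sigma w t).
  move=> hpsi psiE; split.
    have Cpsi : entrywise (regular_process TT F) (fun z => psi z.1 z.2) by [].
    have CP := regular_field_closed hF.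
    by move=> i j; have := entrywise_mul CP Cpsi Csigma i j.
  by apply: aeverywhereS psiE => w t _ ->; rewrite trmx_mul mulmxA.
have lambda_free lambda := @arbitrage_free_of_prices_of_risk _ _ _ P _ _ _ _
  S mu sigma r hTT hF Cmu lambda.
(* Both equivalences are read off the cycle from absence of arbitrage to [psi], from [psi] to
   [lambda = psi sigma], and from [lambda] back. *)
split; split.
- by move=> /free_psi[psi [hpsi psiE]]; eexists; exact: psi_lambda psiE.
- by move=> [lambda]; exact: lambda_free.
- exact: free_psi.
- by move=> [psi [hpsi /(psi_lambda _ hpsi)]]; exact: lambda_free.
Qed.
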